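(* Let $\rho,\sigma,\tau,\{\rho_j\},\{\sigma_j\}$ be density operators on finite-dimensional Hilbert spaces and $\{p_j\}$ a probability distribution. Then: (i) For $\alpha\in(0,1)\cup(1,\infty),\beta\in(-\infty,0)\cup(0,\infty)$: $J'_{\alpha,\beta}(\rho,\sigma)\ge0$, with equality if and only if $\rho=\sigma$. (ii) For $\alpha\in(0,1)\cup(1,\infty),\beta\in(-\infty,0)\cup(0,\infty)$: $J'_{\alpha,\beta}(\rho\otimes\tau,\sigma\otimes\tau)=J'_{\alpha,\beta}(\rho,\sigma)$. (iii) For $\alpha\in(0,1),\beta\in(-\infty,0)\cup(0,1]$ and any quantum operation (CPTP map) $\mathcal E$: $J'_{\alpha,\beta}(\mathcal E(\rho),\mathcal E(\sigma))\le J'_{\alpha,\beta}(\rho,\sigma)$. (iv) For $\alpha\in(0,1)\cup(1,\infty),\beta\in(-\infty,0)\cup(0,\infty)$ and any unitary $U$: $J'_{\alpha,\beta}(U\rho U^\dagger,U\sigma U^\dagger)=J'_{\alpha,\beta}(\rho,\sigma)$. (v) For $\alpha\in(0,1),\beta\in(-\infty,0)\cup(0,1]$: $J'_{\alpha,\beta}\big(\sum_jp_j\rho_j,\sum_jp_j\sigma_j\big)\le\sum_jp_jJ'_{\alpha,\beta}(\rho_j,\sigma_j)$. (vi) For $\alpha\in(0,1)\cup(1,\infty),\beta\in(-\infty,0)\cup(0,\infty)$: $J'_{\alpha,\beta}(\rho,\sigma)=J'_{\alpha,\beta}(\sigma,\rho)$.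
   Context: For density operators $\rho,\sigma$, $\alpha\in(0,1)\cup(1,\infty)$, $\beta\in(-\infty,0)\cup(0,\infty)$, the quantum $(\alpha,\beta)$-relative entropy is $D_{\alpha,\beta}(\rho\|\sigma)=\frac{1}{(1-\alpha)\beta}\big[1-(\mathrm{Tr}(\rho^{\alpha}\sigma^{1-\alpha}))^{\beta}\big]$, where any negative power of a density operator is taken only on its support (zero eigenvalues are kept as zero). The quantum $(\alpha,\beta)$ Jensen–Shannon divergence (second version) is $J'_{\alpha,\beta}(\rho,\sigma)=\tfrac12\big[D_{\alpha,\beta}\big(\rho\|\tfrac{\rho+\sigma}{2}\big)+D_{\alpha,\beta}\big(\sigma\|\tfrac{\rho+\sigma}{2}\big)\big]$. *)

(* Defs.v *)
From HB Require Import structures.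
From mathcomp Require Import all_boot all_order all_algebra.
From mathcomp Require Import boolp reals exp.
From mathcomp Require Import complex mxtens.
Set Implicit Arguments. Unset Strict Implicit. Unset Printing Implicit Defensive.
Import Order.TTheory GRing.Theory Num.Theory.
Local Open Scope ring_scope.
Local Open Scope complex_scope.

Section Quantum.
Variable R : realType.
Local Notation C := R[i].

Definition adjmx {m n} (A : 'M[C]_(m, n)) : 'M[C]_(n, m) :=
  (map_mx (@conjc R) A)^T.

Definition hermitian {n} (A : 'M[C]_n) : Prop := adjmx A = A.

Definition psd {n} (A : 'M[C]_n) : Prop :=
  hermitian A /\ forall v : 'cV[C]_n, 0 <= (adjmx v *m A *m v) 0 0.

Definition density {n} (A : 'M[C]_n) : Prop := psd A /\ \tr A = 1.

Definition unitary {n} (U : 'M[C]_n) : Prop := adjmx U *m U = 1%:M.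

(* real power with the convention that 0 stays 0 (powers taken on the support) *)
Definition spow (x t : R) : R := if x == 0 then 0 else powR x t.

Definition spec_decomp {n} (A : 'M[C]_n) (Ud : 'M[C]_n * 'rV[R]_n) : Prop :=
  unitary Ud.1 /\
  A = Ud.1 *m diag_mx (map_mx (fun x => x%:C) Ud.2) *m adjmx Ud.1.

(* functional calculus A^t := U diag(spow d_i t) U^*, for A Hermitian
   (the result is independent of the chosen decomposition). *)
Definition mpow {n} (A : 'M[C]_n) (t : R) : 'M[C]_n :=
  match pselect (exists Ud, spec_decomp A Ud) with
  | left h => let Ud := projT1 (cid h) in
      Ud.1 *m diag_mx (map_mx (fun x => (spow x t)%:C) Ud.2) *m adjmx Ud.1
  | right _ => 0
  end.

Definition Dab {n} (a b : R) (rho sigma : 'M[C]_n) : R :=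
  (1 - powR (@complex.Re R (\tr (mpow rho a *m mpow sigma (1 - a)))) b) / ((1 - a) * b).

Definition Jab' {n} (a b : R) (rho sigma : 'M[C]_n) : R :=
  let mid := (2%:R : C)^-1 *: (rho + sigma) in
  (Dab a b rho mid + Dab a b sigma mid) / 2.

Definition mxblock {k n} (X : 'M[C]_(k * n)) (i j : 'I_k) : 'M[C]_n :=
  \matrix_(a, b) X (mxtens_index (i, a)) (mxtens_index (j, b)).

Definition ampl {n m} (k : nat) (E : 'M[C]_n -> 'M[C]_m) (X : 'M[C]_(k * n))
  : 'M[C]_(k * m) :=
  \sum_(i < k) \sum_(j < k) (delta_mx i j *t E (mxblock X i j)).

Definition completely_positive {n m} (E : 'M[C]_n -> 'M[C]_m) : Prop :=
  forall (k : nat) (X : 'M[C]_(k * n)), psd X -> psd (@ampl n m k E X).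

Definition trace_preserving {n m} (E : 'M[C]_n -> 'M[C]_m) : Prop :=
  forall X, \tr (E X) = \tr X.

Definition CPTP {n m} (E : {linear 'M[C]_n -> 'M[C]_m}) : Prop :=
  completely_positive E /\ trace_preserving E.

End Quantum.

(* Main.v *)
(** The trace [Tr (rho^a sigma^(1-a))] is, in eigenbases of [rho] and [sigma], the
    sum of [l_i^a m_j^(1-a) |c_ij|^2], where [c] is the unitary overlap matrix;
    definiteness is then the (strict, possibly reversed) weighted AM-GM
    inequality applied termwise, the midpoint state guaranteeing the inclusion
    of supports.  For [0 < a < 1], data processing and joint convexity both come
    from interpolation of weighted l2-norms: a linear map that is a contraction
    for the weights [(w0, w0')] and for [(w1, w1')] is one for the geometric
    means [(w0^s w1^(1-s), w0'^s w1'^(1-s))].  The case [s = 1/2] is an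
    eigenvector argument; it turns a uniform bound [1 + t] into [1 + t/2], hence
    the general case.  For a CPTP map [E] the interpolated map is the dual of
    [E], whose two endpoint bounds are Kadison-Schwarz inequalities; for
    convexity it is the diagonal embedding [X |-> (X, ..., X)]. *)
From HB Require Import structures.
From mathcomp Require Import all_boot all_order all_algebra.
From mathcomp Require Import boolp classical_sets reals topology normedtype.
From mathcomp Require Import sequences exp complex mxtens.
From mathcomp Require Import spectral sesquilinear ring lra.
Require Import Defs.
Import Order.TTheory GRing.Theory Num.Theory.
Set Implicit Arguments. Unset Strict Implicit. Unset Printing Implicit Defensive.
Local Open Scope ring_scope.
Local Open Scope complex_scope.

(** * Adjoints, eigenbases and real powers of Hermitian matrices *)

Section Adjoint.
Variable R : realType.
Local Notation C := R[i].

Lemma adjmxE m n (A : 'M[C]_(m, n)) i j : adjmx A i j = conjc (A j i).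
Proof. by rewrite !mxE. Qed.

Lemma adjmxK m n (A : 'M[C]_(m, n)) : adjmx (adjmx A) = A.
Proof. by apply/matrixP => i j; rewrite !adjmxE conjcK. Qed.

Lemma adjmxM m n p (A : 'M[C]_(m, n)) (B : 'M[C]_(n, p)) :
  adjmx (A *m B) = adjmx B *m adjmx A.
Proof. by rewrite /adjmx map_mxM trmx_mul. Qed.

Lemma adjmxD m n (A B : 'M[C]_(m, n)) : adjmx (A + B) = adjmx A + adjmx B.
Proof. by rewrite /adjmx map_mxD linearD. Qed.

Lemma adjmxZ m n (c : C) (A : 'M[C]_(m, n)) :
  adjmx (c *: A) = conjc c *: adjmx A.
Proof. by rewrite /adjmx map_mxZ linearZ. Qed.

Lemma adjmx1 n : adjmx (1%:M : 'M[C]_n) = 1%:M.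
Proof. by rewrite /adjmx map_mx1 trmx1. Qed.

Lemma adjmx_tens m n p q (A : 'M[C]_(m, n)) (B : 'M[C]_(p, q)) :
  adjmx (A *t B) = adjmx A *t adjmx B.
Proof. by rewrite /adjmx map_mxT trmx_tens. Qed.

Lemma mxtrace_adj n (A : 'M[C]_n) : \tr (adjmx A) = conjc (\tr A).
Proof.
rewrite /adjmx mxtrace_tr /mxtrace rmorph_sum /=.
by apply: eq_bigr => i _; rewrite mxE.
Qed.

Lemma unitary_mulV n (U : 'M[C]_n) : unitary U -> U *m adjmx U = 1%:M.
Proof. by move=> /mulmx1C. Qed.

Lemma unitaryM n (U W : 'M[C]_n) : unitary U -> unitary W -> unitary (U *m W).
Proof.
move=> hU hW; rewrite /unitary adjmxM -mulmxA (mulmxA _ U) hU mul1mx.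
exact: hW.
Qed.

(** Valued in [R], so that weighted sums of squared moduli live in a totally ordered field. *)
Definition sqmod (z : C) : R := complex.Re z ^+ 2 + complex.Im z ^+ 2.

Lemma sqmodE (z : C) : (sqmod z)%:C = conjc z * z.
Proof.
by case: z => x y; rewrite /sqmod /=; simpc; congr (_ +i* _); rewrite ?expr2; lra.
Qed.

Lemma sqmod_ge0 z : 0 <= sqmod z.
Proof. by rewrite addr_ge0 ?sqr_ge0. Qed.

Lemma sqmod_eq0 z : (sqmod z == 0) = (z == 0).
Proof.
rewrite /sqmod paddr_eq0 ?sqr_ge0// !sqrf_eq0.
by rewrite eq_complex.
Qed.

Lemma sqmod0 : sqmod 0 = 0.
Proof. by apply/eqP; rewrite sqmod_eq0. Qed.

Lemma sqmodM y z : sqmod (y * z) = sqmod y * sqmod z.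
Proof. by case: y z => [a b] [c d]; rewrite /sqmod; simpc => /=; ring. Qed.

Lemma sqmod_real (x : R) : sqmod x%:C = x ^+ 2.
Proof. by rewrite /sqmod /= expr0n addr0. Qed.

Definition cdiag n (d : 'I_n -> R) : 'M[C]_n := diag_mx (\row_i (d i)%:C).

Lemma cdiagE n (d : 'I_n -> R) i j : cdiag d i j = (d i)%:C *+ (i == j).
Proof. by rewrite !mxE. Qed.

Lemma adjmx_cdiag n (d : 'I_n -> R) : adjmx (cdiag d) = cdiag d.
Proof.
apply/matrixP => i j; rewrite adjmxE !cdiagE rmorphMn /= oppr0 eq_sym.
by case: eqP => // ->.
Qed.

Lemma cdiag1 n : cdiag (fun=> 1) = 1%:M :> 'M[C]_n.
Proof. by apply/matrixP => i j; rewrite cdiagE mxE rmorph1. Qed.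

(** A form of [spec_decomp] with the eigenvalues as a function, so that functional calculus is
    composition. *)
Definition spectral n (A U : 'M[C]_n) (d : 'I_n -> R) :=
  unitary U /\ A = U *m cdiag d *m adjmx U.

Lemma spec_decomp_spectral n (A : 'M[C]_n) Ud :
  spec_decomp A Ud -> spectral A Ud.1 (Ud.2 0).
Proof.
case=> hU hA; split=> //; rewrite {1}hA; congr (_ *m diag_mx _ *m _).
by apply/rowP => i; rewrite !mxE.
Qed.

Lemma hermitian_spectral n (A : 'M[C]_n) :
  hermitian A -> exists Ud, spec_decomp A Ud.
Proof.
move=> hA.
have hs : A \is hermitianmx n false (@Num.Def.conjC C).
  apply/is_hermitianmxP; rewrite expr0 scale1r.
  by rewrite -{1}hA; apply/matrixP => i j; rewrite !mxE.
have /orthomx_spectralP hE := hermitian_normalmx hs.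
have hP := spectral_unitarymx A.
have /mxOverP hd := hermitian_spectral_diag_real hs.
rewrite (invmx_unitary hP) in hE.
have hadj (B : 'M[C]_n) : ((B ^t* )%sesqui) = adjmx B.
  by apply/matrixP => i j; rewrite !mxE.
rewrite hadj in hE.
exists (adjmx (spectralmx A), \row_i complex.Re (spectral_diag A 0 i)); split => /=.
  rewrite /unitary adjmxK; have /unitarymxP := hP; by rewrite hadj.
rewrite adjmxK {1}hE; congr (_ *m diag_mx _ *m _); apply/rowP => i.
by rewrite !mxE RRe_real.
Qed.

Lemma spectral_exists n (A : 'M[C]_n) :
  hermitian A -> exists U d, spectral A U d.
Proof.
by move=> /hermitian_spectral[Ud /spec_decomp_spectral hA]; exists Ud.1, (Ud.2 0).
Qed.

(** The overlap [adjmx U *m W] intertwines the two diagonal matrices, so its entry (i, j) vanishes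
    unless [d i = e j]; hence it also intertwines their images under [f]. Functional calculus thus
    does not depend on the eigenbasis. *)
Lemma spectral_fun n (A U W : 'M[C]_n) d e (f : R -> R) :
  spectral A U d -> spectral A W e ->
  U *m cdiag (f \o d) *m adjmx U = W *m cdiag (f \o e) *m adjmx W.
Proof.
move=> [hU hA] [hW hA'].
have hc : cdiag d *m (adjmx U *m W) = (adjmx U *m W) *m cdiag e.
  have : adjmx U *m A *m W = adjmx U *m A *m W by [].
  rewrite {1}hA hA' !mulmxA hU mul1mx -!mulmxA hW mulmx1 !mulmxA.
  by [].
have hf : cdiag (f \o d) *m (adjmx U *m W) = (adjmx U *m W) *m cdiag (f \o e).
  apply/matrixP => i j; move/matrixP/(_ i j): hc.
  rewrite !mul_diag_mx !mul_mx_diag !mxE; set c := \sum__ _.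
  have [->|c0] := eqVneq c 0; first by rewrite !mulr0 !mul0r.
  by rewrite mulrC => /(mulfI c0)/complexI hde; rewrite /= hde mulrC.
rewrite -[LHS]mulmx1 -(unitary_mulV hW) !mulmxA.
rewrite -(mulmxA _ (adjmx U) W) -(mulmxA U) hf !mulmxA.
by rewrite unitary_mulV// mul1mx.
Qed.

Lemma mpow_spectral n (A U : 'M[C]_n) d t :
  spectral A U d -> mpow A t = U *m cdiag (fun i => spow (d i) t) *m adjmx U.
Proof.
move=> hA; rewrite /mpow; case: pselect => [h|[]]; last first.
  exists (U, \row_i d i); case: hA => hU hA; split=> //=.
  rewrite {1}hA; congr (_ *m diag_mx _ *m _).
  by apply/rowP => i; rewrite !mxE.
case: cid => -[V e] /= /spec_decomp_spectral /= hV.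
transitivity (V *m cdiag ((fun x => spow x t) \o e 0) *m adjmx V); last first.
  exact: esym (spectral_fun (fun x => spow x t) hA hV).
by congr (_ *m _ *m _); apply/matrixP => i j; rewrite !mxE.
Qed.

Lemma mxtrace_sandwich n m (X : 'M[C]_(n, m)) d e :
  \tr (adjmx X *m cdiag d *m X *m cdiag e) =
  (\sum_i \sum_j d i * e j * sqmod (X i j))%:C.
Proof.
rewrite exchange_big rmorph_sum /=; apply: eq_bigr => j _.
rewrite mul_mx_diag mxE [X in X * _]mxE mulr_suml rmorph_sum /=.
apply: eq_bigr => i _.
by rewrite mul_mx_diag !mxE !rmorphM /= sqmodE; ring.
Qed.

(** The bridge from traces to weighted l2-norms: products of eigenvalues are the weights, and the
    entries of [X] in the two eigenbases are the coordinates. *)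
Lemma mxtrace_spectral n m (U : 'M[C]_n) (W : 'M[C]_m) d e X :
  unitary U -> unitary W ->
  \tr (adjmx X *m (U *m cdiag d *m adjmx U) *m X *m (W *m cdiag e *m adjmx W))
  = (\sum_i \sum_j d i * e j * sqmod ((adjmx U *m X *m W) i j))%:C.
Proof.
move=> hU hW; rewrite -mxtrace_sandwich !adjmxM adjmxK.
rewrite !mulmxA mxtrace_mulC !mulmxA.
by [].
Qed.

Lemma adj_cV_diag n (v : 'cV[C]_n) d :
  (adjmx v *m cdiag d *m v) 0 0 = (\sum_i d i * sqmod (v i 0))%:C.
Proof.
rewrite mul_mx_diag mxE rmorph_sum; apply: eq_bigr => i _.
by rewrite !mxE /= !rmorphM /= sqmodE; ring.
Qed.

Lemma spectral_ge0 n (A U : 'M[C]_n) d :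
  psd A -> spectral A U d -> forall i, 0 <= d i.
Proof.
move=> [_ hA] [hU hd] i.
have := hA (U *m delta_mx i 0).
rewrite adjmxM hd !mulmxA -(mulmxA _ _ U) hU mulmx1.
rewrite -(mulmxA _ _ U) hU mulmx1 adj_cV_diag ler0c (bigD1 i)//= big1.
  rewrite mxE !eqxx /= addr0 sqmod_real expr1n mulr1; exact.
by move=> j ji; rewrite mxE (negbTE ji) sqmod0 mulr0.
Qed.

Lemma spectral_psd n (A U : 'M[C]_n) d :
  spectral A U d -> (forall i, 0 <= d i) -> psd A.
Proof.
move=> [hU ->] hd; split.
  by rewrite /hermitian !adjmxM adjmxK adjmx_cdiag mulmxA.
move=> v.
have -> : adjmx v *m (U *m cdiag d *m adjmx U) *m v
   = adjmx (adjmx U *m v) *m cdiag d *m (adjmx U *m v).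
  by rewrite adjmxM adjmxK !mulmxA.
rewrite adj_cV_diag ler0c; apply: sumr_ge0 => i _.
by rewrite mulr_ge0 ?sqmod_ge0.
Qed.

Lemma mxtrace_cdiag n (U : 'M[C]_n) d : unitary U ->
  \tr (U *m cdiag d *m adjmx U) = (\sum_i d i)%:C.
Proof.
move=> hU; rewrite mxtrace_mulC mulmxA hU mul1mx rmorph_sum /mxtrace.
by apply: eq_bigr => i _; rewrite cdiagE eqxx.
Qed.

Lemma spectral_sum1 n (A U : 'M[C]_n) d :
  density A -> spectral A U d -> \sum_i d i = 1.
Proof.
move=> [_ trA] [hU hA]; move: trA; rewrite hA mxtrace_cdiag//.
by move=> /complexI.
Qed.

End Adjoint.

(** * Contractions between weighted l2-spaces, and the geometric mean of two weights *)

Section Midpoint.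
Variable R : realType.
Local Notation C := R[i].

Lemma hermitian_form_le1 n (A : 'M[C]_n) : hermitian A ->
  (forall l (v : 'cV[C]_n), v != 0 -> A *m v = l%:C *: v -> l <= 1) ->
  forall v : 'cV[C]_n,
    complex.Re ((adjmx v *m A *m v) 0 0) <= \sum_i sqmod (v i 0).
Proof.
move=> /spectral_exists[U [d [hU hA]]] heig v.
have d1 i : d i <= 1.
  apply: (heig _ (U *m delta_mx i 0)).
    apply/eqP => /(congr1 (mulmx (adjmx U))).
    rewrite mulmxA hU mul1mx mulmx0 => /matrixP/(_ i 0).
    by rewrite !mxE !eqxx => /eqP; rewrite oner_eq0.
  rewrite hA -!mulmxA (mulmxA _ U) hU mul1mx scalemxAr; congr (_ *m _).
  rewrite mul_diag_mx; apply/matrixP => j k; rewrite !mxE.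
  by have [->|] := eqVneq j i; rewrite /= ?mulr1 ?mulr0.
have -> : adjmx v *m A *m v = adjmx (adjmx U *m v) *m cdiag d *m (adjmx U *m v).
  by rewrite adjmxM adjmxK hA !mulmxA.
have hv e : (adjmx v *m v = adjmx (adjmx U *m v) *m cdiag e *m (adjmx U *m v)) ->
   (\sum_i sqmod (v i 0))%:C = (\sum_i e i * sqmod ((adjmx U *m v) i 0))%:C.
  move=> /matrixP/(_ 0 0); rewrite adj_cV_diag => <-.
  rewrite -[adjmx v]mulmx1 -cdiag1 adj_cV_diag; congr (_%:C).
  by apply: eq_bigr => i _; rewrite mul1r.
rewrite (complexI (hv (fun=> 1) _)).
  rewrite adj_cV_diag /=; apply: ler_sum => i _.
  by rewrite ler_wpM2r ?sqmod_ge0.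
by rewrite cdiag1 mulmx1 adjmxM adjmxK mulmxA -(mulmxA _ U) unitary_mulV ?mulmx1.
Qed.

(** Transport to an arbitrary finite index type, since the index sets used later are products. *)
Lemma hermitian_fun_le1 (I : finType) (H : I -> I -> C) :
  (forall i j, conjc (H j i) = H i j) ->
  (forall l (v : I -> C), (exists i, v i != 0) ->
     (forall i, \sum_j H i j * v j = l%:C * v i) -> l <= 1) ->
  forall v : I -> C,
    complex.Re (\sum_i \sum_j conjc (v i) * H i j * v j) <= \sum_i sqmod (v i).
Proof.
move=> hH heig v.
pose A : 'M[C]_#|I| := \matrix_(i, j) H (enum_val i) (enum_val j).
have hA : hermitian A by apply/matrixP => i j; rewrite adjmxE !mxE.
have re (F : I -> C) : \sum_i F i = \sum_(i < #|I|) F (enum_val i).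
  by rewrite (reindex _ (onW_bij _ (enum_val_bij I))).
have -> : \sum_i sqmod (v i) = \sum_(i < #|I|) sqmod ((\col_i v (enum_val i)) i 0).
  rewrite (reindex _ (onW_bij _ (enum_val_bij I))).
  by apply: eq_bigr => i _; rewrite mxE.
apply: le_trans (hermitian_form_le1 hA _ _).
  rewrite le_eqVlt; apply/orP; left; apply/eqP; congr complex.Re.
  rewrite exchange_big re mxE; apply: eq_bigr => j _.
  rewrite !mxE mulr_suml re; apply: eq_bigr => i _.
  by rewrite !mxE.
move=> l w w0 hw; apply: (heig l (fun i => w (enum_rank i) 0)).
  case/matrix0Pn: w0 => i [j]; rewrite ord1 => wij.
  by exists (enum_val i); rewrite enum_valK.
move=> i; move/matrixP/(_ (enum_rank i) 0): hw; rewrite !mxE => <-.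
by rewrite re; apply: eq_bigr => j _; rewrite mxE enum_rankK enum_valK.
Qed.

(** Expansion of the squared modulus of [s * u - t * w], where [s] and [t] are the square roots of
    [p] and [q]. *)
Lemma Re_conjM_le (p q : R) (u w : C) : 0 <= p -> 0 <= q ->
  Num.sqrt (p * q) * complex.Re (conjc u * w) <= (p * sqmod u + q * sqmod w) / 2.
Proof.
move=> p0 q0; rewrite sqrtrM// -{2}(sqr_sqrtr p0) -{2}(sqr_sqrtr q0).
move: (Num.sqrt p) (Num.sqrt q) => s t.
case: u w => [a b] [c d]; rewrite /sqmod; simpc => /=.
have := sqr_ge0 (s * a - t * c); have := sqr_ge0 (s * b - t * d); nra.
Qed.

Lemma Re_sum (J : finType) (F : J -> C) :
  complex.Re (\sum_j F j) = \sum_j complex.Re (F j).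
Proof. by apply: (big_morph (@complex.Re R)) => // -[a b] [c d]. Qed.

Lemma ReZ (x : R) (z : C) : complex.Re (x%:C * z) = x * complex.Re z.
Proof. by case: z => a b; simpc. Qed.

Variables (K I : finType).
Implicit Types (T : K -> I -> C) (x z : I -> C).

Definition fapp T x k : C := \sum_i T k i * x i.

Definition dominated T (w : K -> R) (w' : I -> R) :=
  forall x, \sum_k w k * sqmod (fapp T x k) <= \sum_i w' i * sqmod (x i).

(** The matrix of the pullback along [T] of the inner product with weight [g]. *)
Definition gram T (g : K -> R) i j : C := \sum_k (g k)%:C * (conjc (T k i) * T k j).

Lemma gram_form T g z x :
  \sum_i \sum_j conjc (z i) * gram T g i j * x j =
  \sum_k (g k)%:C * (conjc (fapp T z k) * fapp T x k).
Proof.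
transitivity (\sum_i \sum_j \sum_k
   (g k)%:C * (conjc (T k i * z i) * (T k j * x j))).
  apply: eq_bigr => i _; apply: eq_bigr => j _.
  rewrite /gram mulr_sumr mulr_suml; apply: eq_bigr => k _.
  by rewrite rmorphM /=; ring.
under eq_bigr do rewrite exchange_big.
rewrite exchange_big; apply: eq_bigr => k _.
rewrite /fapp rmorph_sum mulr_suml mulr_sumr; apply: eq_bigr => i _.
by rewrite mulr_sumr mulr_sumr.
Qed.

(* An eigenvector v of the Gram matrix with eigenvalue l is tested against
   z = v / p'; then <z, v> equals both squared weighted norms of z and v. *)
Lemma dominated_mid1 T (p q : K -> R) (p' : I -> R) :
  (forall k, 0 <= p k) -> (forall k, 0 <= q k) -> (forall i, 0 < p' i) ->
  dominated T p p' -> dominated T q (fun i => (p' i)^-1) ->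
  dominated T (fun k => Num.sqrt (p k * q k)) (fun=> 1).
Proof.
move=> p0 q0 p'0 hp hq x.
pose g k := Num.sqrt (p k * q k).
have herm i j : conjc (gram T g j i) = gram T g i j.
  rewrite /gram rmorph_sum; apply: eq_bigr => k _.
  by rewrite !(rmorphM (@conjc R)) /= conjcK oppr0; congr (_ * _); rewrite mulrC.
have := hermitian_fun_le1 herm _ x.
rewrite gram_form Re_sum => h.
under [leRHS]eq_bigr do rewrite mul1r.
apply: le_trans (h _); first apply: ler_sum => k _.
  by rewrite -sqmodE -rmorphM.
move=> l v [i0 vi0] hl.
pose z i : C := ((p' i)^-1)%:C * v i.
pose S := \sum_i (p' i)^-1 * sqmod (v i).
have S0 : 0 < S.
  rewrite /S (bigD1 i0)//= ltr_wpDr//.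
    by apply: sumr_ge0 => i _; rewrite mulr_ge0 ?sqmod_ge0// invr_ge0 ltW.
  by rewrite mulr_gt0 ?invr_gt0// lt_def sqmod_eq0 vi0 sqmod_ge0.
have hzS : \sum_i p' i * sqmod (z i) = S.
  apply: eq_bigr => i _; rewrite sqmodM sqmod_real.
  by rewrite mulrA expr2 mulrA divff ?gt_eqF// mul1r.
have : complex.Re (\sum_i \sum_j conjc (z i) * gram T g i j * v j) = l * S.
  under eq_bigr => i _.
    under eq_bigr do rewrite -mulrA.
    rewrite -mulr_sumr hl.
    over.
  rewrite Re_sum mulr_sumr; apply: eq_bigr => i _.
  rewrite /z rmorphM /= oppr0.
  have -> : (p' i)^-1%:C * conjc (v i) * (l%:C * v i) =
     (l * ((p' i)^-1 * sqmod (v i)))%:C.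
    by rewrite !rmorphM /= sqmodE; ring.
  by [].
rewrite gram_form Re_sum => hS.
have : l * S <= (S + S) / 2.
  rewrite -hS.
  (* After the termwise arithmetic-geometric bound, [hp] is applied to [z] and [hq] to [v]; both
     right-hand sides equal [S], whence [l <= 1]. *)
  apply: (@le_trans _ _
    (\sum_k (p k * sqmod (fapp T z k) + q k * sqmod (fapp T v k)) / 2)).
    by apply: ler_sum => k _; rewrite ReZ; apply: Re_conjM_le.
  rewrite -mulr_suml big_split /= ler_pM2r ?invr_gt0//.
  by apply: lerD; [rewrite -hzS; exact: hp | exact: hq].
move=> h2; rewrite -(ler_pM2r S0) mul1r; lra.
Qed.

(** Rescaling coordinate [i] by the fourth root [h i] of [p' i * q' i] turns the right-hand weights
    into [p' i / g i] and [q' i / g i], which are inverse to each other, as [dominated_mid1]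
    requires. *)
Lemma dominated_mid T (p q : K -> R) (p' q' : I -> R) :
  (forall k, 0 <= p k) -> (forall k, 0 <= q k) ->
  (forall i, 0 < p' i) -> (forall i, 0 < q' i) ->
  dominated T p p' -> dominated T q q' ->
  dominated T (fun k => Num.sqrt (p k * q k)) (fun i => Num.sqrt (p' i * q' i)).
Proof.
move=> p0 q0 p'0 q'0 hp hq x.
pose g i := Num.sqrt (p' i * q' i).
have g0 i : 0 < g i by rewrite sqrtr_gt0 mulr_gt0.
have gg i : g i * g i = p' i * q' i.
  by rewrite -expr2 sqr_sqrtr// mulr_ge0 ?ltW.
pose h i := Num.sqrt (g i).
have h0 i : 0 < h i by rewrite sqrtr_gt0.
have hh i : h i ^+ 2 = g i by rewrite sqr_sqrtr// ltW.
pose T' k i : C := ((h i)^-1)%:C * T k i.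
have fT y k : fapp T' y k = fapp T (fun i => ((h i)^-1)%:C * y i) k.
  by apply: eq_bigr => i _; rewrite /T'; ring.
have hT' w w' : dominated T w w' -> dominated T' w (fun i => w' i / g i).
  move=> hw y; under eq_bigr do rewrite fT.
  apply: le_trans (hw _) _; apply: ler_sum => i _.
  by rewrite sqmodM sqmod_real exprVn hh mulrA.
have e k : fapp T' (fun i => (h i)%:C * x i) k = fapp T x k.
  rewrite fT; apply: eq_bigr => i _; rewrite [X in _ * X]mulrA -rmorphM.
  by rewrite mulVf ?gt_eqF// rmorph1 mul1r.
have a0 i : 0 < p' i / g i by rewrite divr_gt0.
have hq1 : dominated T' q (fun i => (p' i / g i)^-1).
  move=> y; apply: le_trans (hT' _ _ hq y) _; apply: ler_sum => i _.
  rewrite ler_wpM2r ?sqmod_ge0// invf_div ler_pdivrMr// mulrAC gg.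
  by rewrite mulrAC divff ?mul1r ?gt_eqF.
have := dominated_mid1 p0 q0 a0 (hT' _ _ hp) hq1 (fun i => (h i)%:C * x i).
under eq_bigr do rewrite e.
by under [leRHS]eq_bigr do rewrite mul1r sqmodM sqmod_real hh.
Qed.

End Midpoint.

(** * Weighted geometric means and their comparison with arithmetic means *)

Section PowerMean.
Variable R : realType.
Implicit Types (a x y s t : R).

(** Exponents outside [0, 1] also occur; there the arithmetic-geometric inequality is reversed. *)
Definition wmean s x y : R := x `^ s * y `^ (1 - s).

Lemma wmean_ge0 s x y : 0 <= wmean s x y.
Proof. by rewrite mulr_ge0 ?powR_ge0. Qed.

Lemma wmean_gt0 s x y : 0 < x -> 0 < y -> 0 < wmean s x y.
Proof. by move=> x0 y0; rewrite mulr_gt0 ?powR_gt0. Qed.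

Lemma wmeanC s x y : wmean s x y = wmean (1 - s) y x.
Proof. by rewrite /wmean subKr mulrC. Qed.

Lemma wmean0 x y : 0 <= y -> wmean 0 x y = y.
Proof. by move=> y0; rewrite /wmean powRr0 mul1r subr0 powRr1. Qed.

Lemma wmean1 x y : 0 <= x -> wmean 1 x y = x.
Proof. by move=> x0; rewrite /wmean subrr powRr0 mulr1 powRr1. Qed.

Lemma wmeanxx s x : 0 <= x -> wmean s x x = x.
Proof.
by move=> x0; rewrite /wmean -powRD ?subrKC ?powRr1// oner_eq0.
Qed.

Lemma wmean_expR s x y : 0 < x -> 0 < y ->
  wmean s x y = expR (s * ln x + (1 - s) * ln y).
Proof. by move=> x0 y0; rewrite /wmean /powR !gt_eqF// expRD. Qed.

(* Both arguments are compared with their weighted mean through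
   1 + u < expR u. *)
Lemma wmean_lt a x y : 0 < a < 1 -> 0 <= x -> 0 <= y -> x != y ->
  wmean a x y < a * x + (1 - a) * y.
Proof.
move=> /andP[a0 a1]; have a1' : 0 < 1 - a by rewrite subr_gt0.
rewrite le_eqVlt => /predU1P[<-|x0].
  rewrite le_eqVlt => /predU1P[<-|y0 _]; first by rewrite eqxx.
  by rewrite /wmean powR0 ?gt_eqF// mul0r mulr0 add0r mulr_gt0.
rewrite le_eqVlt => /predU1P[<- _|y0 xy].
  by rewrite /wmean powR0 ?gt_eqF// !mulr0 addr0 mulr_gt0.
rewrite wmean_expR//.
set m := _ + _.
have lxy : ln x - ln y != 0.
  by rewrite subr_eq0; apply: contra xy => /eqP/ln_inj ->; rewrite ?posrE.
have hx : x = expR m * expR ((1 - a) * (ln x - ln y)).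
  rewrite -expRD -[LHS]lnK ?posrE//; congr expR; rewrite /m; ring.
have hy : y = expR m * expR (a * (ln y - ln x)).
  rewrite -expRD -[LHS]lnK ?posrE//; congr expR; rewrite /m; ring.
have g0 := expR_gt0 m.
(* One strict inequality is enough: [x != y] makes this exponent nonzero. *)
have h1 : 1 + (1 - a) * (ln x - ln y) < expR ((1 - a) * (ln x - ln y)).
  by apply: expR_gt1Dx; rewrite mulf_neq0// gt_eqF.
have h2 : 1 + a * (ln y - ln x) <= expR (a * (ln y - ln x)).
  exact: expR_ge1Dx.
have -> : a * x + (1 - a) * y = expR m *
    (a * expR ((1 - a) * (ln x - ln y)) + (1 - a) * expR (a * (ln y - ln x))).
  by rewrite mulrDr; congr (_ + _); [rewrite {1}hx | rewrite {1}hy]; ring.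
rewrite -[ltLHS]mulr1 ltr_pM2l//.
have h1' : a * (1 + (1 - a) * (ln x - ln y)) < a * expR ((1 - a) * (ln x - ln y)).
  by rewrite ltr_pM2l.
have := ler_wpM2l (ltW a1') h2; lra.
Qed.

Lemma wmean_le a x y : 0 < a < 1 -> 0 <= x -> 0 <= y ->
  wmean a x y <= a * x + (1 - a) * y.
Proof.
move=> ha x0 y0; have [<-|xy] := eqVneq x y.
  rewrite wmeanxx//; lra.
exact/ltW/wmean_lt.
Qed.

(** For [x > 0], the number [x] is itself the mean of [Q] and [y] with exponent [a^-1] in (0, 1), so
    the strict inequality for [Q] and [y], multiplied by [a], rearranges to the claim. *)
Lemma wmean_gt a x y : 1 < a -> 0 <= x -> 0 < y -> x != y ->
  a * x + (1 - a) * y < wmean a x y.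
Proof.
move=> a1; have a0 : 0 < a by rewrite (lt_trans _ a1).
rewrite le_eqVlt => /predU1P[<- y0 _|x0 y0 xy].
  rewrite /wmean powR0 ?gt_eqF// mul0r mulr0 add0r nmulr_rlt0//; lra.
set Q := wmean a x y.
have Q0 : 0 < Q by apply: wmean_gt0.
have hx : x = wmean a^-1 Q y.
  rewrite wmean_expR// /Q wmean_expR// expRK -[LHS]lnK ?posrE//; congr expR.
  by field; rewrite gt_eqF.
have Qy : Q != y.
  by apply: contra xy => /eqP Qy; rewrite hx Qy wmeanxx// ltW.
have ha : 0 < a^-1 < 1 by rewrite invr_gt0 a0 invf_lt1.
have := wmean_lt ha (ltW Q0) (ltW y0) Qy; rewrite -hx.
rewrite -(ltr_pM2l a0).
have -> : a * (a^-1 * Q + (1 - a^-1) * y) = Q + (a - 1) * y.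
  by field; rewrite gt_eqF.
lra.
Qed.

Lemma wmean_ge a x y : 1 < a -> 0 <= x -> 0 < y ->
  a * x + (1 - a) * y <= wmean a x y.
Proof.
move=> ha x0 y0; have [<-|xy] := eqVneq x y.
  rewrite wmeanxx//; lra.
exact/ltW/wmean_gt.
Qed.

Lemma wmean_leD s x y : 0 <= s <= 1 -> 0 <= x -> 0 <= y -> wmean s x y <= x + y.
Proof.
move=> /andP[]; rewrite le_eqVlt => /predU1P[<- _ x0 y0|s0].
  by rewrite wmean0// lerDr.
rewrite le_eqVlt => /predU1P[-> x0 y0|s1 x0 y0]; first by rewrite wmean1// lerDl.
have hs : 0 < s < 1 by rewrite s0.
apply: le_trans (wmean_le hs x0 y0) _; nra.
Qed.

Lemma wmean_ge_min s x y : 0 <= s <= 1 -> 0 < x -> x <= y -> x <= wmean s x y.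
Proof.
move=> /andP[s0 s1] x0 xy; rewrite -{1}(wmeanxx s (ltW x0)) ler_wpM2l ?powR_ge0//.
have y0 := lt_le_trans x0 xy.
by rewrite ge0_ler_powR ?subr_ge0// nnegrE ltW.
Qed.

(** The constant is independent of [s], which gives a bound uniform in [s] to start the halving
    from. The mean is at least the smaller argument, and the constant times that argument exceeds
    the sum. *)
Lemma addr_le_wmean s x y : 0 <= s <= 1 -> 0 < x -> 0 < y ->
  x + y <= (2 + x / y + y / x) * wmean s x y.
Proof.
wlog xy : s x y / x <= y => [hw hs x0 y0|hs x0 y0].
  have [xy|yx] := leP x y; first exact: hw.
  rewrite wmeanC addrC -addrA [_ / _ + _]addrC addrA; apply: hw => //.
    exact: ltW.
  by case/andP: hs => s0 s1; rewrite subr_ge0 s1 lerBlDr lerDl.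
have h := wmean_ge_min hs x0 xy.
apply: (@le_trans _ _ ((2 + x / y + y / x) * x)); last first.
  by rewrite ler_wpM2l// !addr_ge0// divr_ge0// ltW.
rewrite !mulrDl [y / x * x]divfK ?gt_eqF// lerD2r.
have : 0 <= x / y * x by rewrite mulr_ge0 ?divr_ge0// ltW.
lra.
Qed.

(** The exponent [s] is the midpoint of 0 and [2 * s]; when [s] is at least 1/2, the next lemma uses
    the midpoint of 1 and [2 * s - 1]. *)
Lemma sqrt_mul_wmean s x y : 0 <= s -> 2 * s <= 1 -> 0 <= x -> 0 <= y ->
  Num.sqrt (y * wmean (2 * s) x y) = wmean s x y.
Proof.
move=> s0 s1 x0 y0; rewrite -[RHS]ger0_norm ?wmean_ge0// -sqrtr_sqr; congr Num.sqrt.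
have sq z r : 0 <= z -> z `^ (r * 2) = (z `^ r) ^+ 2.
  by move=> z0; rewrite powRrM powR_mulrn// powR_ge0.
rewrite /wmean exprMn -!sq// mulrCA mulrC [s * 2]mulrC mulrC; congr (_ * _).
rewrite -{1}(powRr1 y0) -powRD; first by congr powR; ring.
by apply/implyP => /eqP; lra.
Qed.

Lemma sqrt_mul_wmean1 s x y : 0 <= 2 * s - 1 -> s <= 1 -> 0 <= x -> 0 <= y ->
  Num.sqrt (x * wmean (2 * s - 1) x y) = wmean s x y.
Proof.
move=> s0 s1 x0 y0; rewrite wmeanC [RHS]wmeanC.
have -> : 1 - (2 * s - 1) = 2 * (1 - s) by ring.
rewrite sqrt_mul_wmean ?subr_ge0//; lra.
Qed.

End PowerMean.

(** * Interpolation between two pairs of weights, positive on the source side *)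

Section Interpolation.
Variable R : realType.
Local Notation C := R[i].
Variables (K I : finType) (T : K -> I -> C).

Lemma dominated_le (w : K -> R) (w1 w2 : I -> R) :
  (forall i, w1 i <= w2 i) -> dominated T w w1 -> dominated T w w2.
Proof.
move=> h hw x; apply: le_trans (hw x) _; apply: ler_sum => i _.
by rewrite ler_wpM2r ?sqmod_ge0.
Qed.

Lemma eq_dominated (w1 w2 : K -> R) (w : I -> R) :
  (forall k, w1 k = w2 k) -> dominated T w1 w -> dominated T w2 w.
Proof. by move=> h hw x; under eq_bigr do rewrite -h; exact: hw. Qed.

Section Positive.
Variables (a b : K -> R) (a' b' : I -> R).
Hypotheses (a0 : forall k, 0 <= a k) (b0 : forall k, 0 <= b k).
Hypotheses (a'0 : forall i, 0 < a' i) (b'0 : forall i, 0 < b' i).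
Hypotheses (ha : dominated T a a') (hb : dominated T b b').

(** Uniformity in [s] matters: the bound at [s] is improved by using the one at [2 * s] or
    [2 * s - 1]. *)
Let bounded t := forall s, 0 <= s <= 1 ->
  dominated T (fun k => wmean s (a k) (b k))
              (fun i => (1 + t) * wmean s (a' i) (b' i)).

Let sqrt1D (t : R) : 0 <= t -> Num.sqrt (1 + t) <= 1 + t / 2.
Proof.
move=> t0; rewrite -[leRHS]ger0_norm; last by lra.
by rewrite -sqrtr_sqr ler_wsqrtr//; have := sqr_ge0 (t / 2); lra.
Qed.

(** Taking the midpoint with an endpoint, where there is no loss, replaces the factor [1 + t] by its
    square root, which is at most [1 + t / 2]. *)
Let bounded_half t : 0 <= t -> bounded t -> bounded (t / 2).
Proof.
move=> t0 ht s /andP[s0 s1].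
have step (u : R) (p : K -> R) (p' : I -> R) : 0 <= u <= 1 ->
    (forall k, 0 <= p k) -> (forall i, 0 < p' i) -> dominated T p p' ->
    (forall k, Num.sqrt (p k * wmean u (a k) (b k)) = wmean s (a k) (b k)) ->
    (forall i, Num.sqrt (p' i * wmean u (a' i) (b' i)) = wmean s (a' i) (b' i)) ->
    dominated T (fun k => wmean s (a k) (b k))
       (fun i => (1 + t / 2) * wmean s (a' i) (b' i)).
  move=> hu p0 p'0 hp e e'.
  have w0 i : 0 < (1 + t) * wmean u (a' i) (b' i).
    by rewrite mulr_gt0 ?wmean_gt0// ltr_wpDr.
  have := dominated_mid p0 (fun k => wmean_ge0 u (a k) (b k)) p'0 w0 hp (ht u hu).
  move=> /(eq_dominated e); apply: dominated_le => i.
  rewrite mulrCA sqrtrM ?e'; last by lra.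
  by rewrite ler_wpM2r ?wmean_ge0 ?sqrt1D.
have [hs|hs] := leP (2 * s) 1.
  apply: (step (2 * s) b b') => // [|k|i].
  - by rewrite hs andbT mulr_ge0.
  - by rewrite sqrt_mul_wmean.
  - by rewrite sqrt_mul_wmean// ltW.
apply: (step (2 * s - 1) a a') => // [|k|i].
- by apply/andP; split; lra.
- by rewrite sqrt_mul_wmean1// subr_ge0 ltW.
- by rewrite sqrt_mul_wmean1// ?subr_ge0 ltW.
Qed.

Let bounded_exists : exists2 t, 0 <= t & bounded t.
Proof.
pose c i := 2 + a' i / b' i + b' i / a' i.
have c0 i : 0 <= c i by rewrite !addr_ge0// divr_ge0// ltW.
(* The sum serves as a common upper bound of all [c i], in place of a maximum. *)
exists (\sum_i c i); first exact: sumr_ge0.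
move=> s hs x.
apply: (@le_trans _ _ (\sum_k (a k + b k) * sqmod (fapp T x k))).
  by apply: ler_sum => k _; rewrite ler_wpM2r ?sqmod_ge0 ?wmean_leD.
under eq_bigr do rewrite mulrDl.
rewrite big_split /=; apply: le_trans (lerD (ha x) (hb x)) _.
rewrite -big_split /=; apply: ler_sum => i _.
rewrite -mulrDl ler_wpM2r ?sqmod_ge0//.
apply: le_trans (addr_le_wmean hs (a'0 i) (b'0 i)) _.
rewrite ler_wpM2r ?wmean_ge0// (bigD1 i)//= /c.
have : 0 <= \sum_(j | j != i) c j by exact: sumr_ge0.
rewrite /c; lra.
Qed.

Lemma dominated_wmean_pos s : 0 <= s <= 1 ->
  dominated T (fun k => wmean s (a k) (b k)) (fun i => wmean s (a' i) (b' i)).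
Proof.
move=> hs x; have [t t0 ht] := bounded_exists.
have hn n : bounded (t / 2 ^+ n).
  elim: n => [|n ih]; first by rewrite expr0 divr1.
  rewrite exprSr invfM mulrA; apply: bounded_half => //.
  by rewrite divr_ge0// exprn_ge0.
set S := leRHS; set L := leLHS.
have S0 : 0 <= S by apply: sumr_ge0 => i _; rewrite mulr_ge0 ?wmean_ge0 ?sqmod_ge0.
have hL n : L <= (1 + t / 2 ^+ n) * S.
  apply: le_trans (hn n s hs x) _; rewrite mulr_sumr; apply: ler_sum => i _.
  by rewrite -[leLHS]mulrA.
apply/ler_addgt0Pr => e e0.
(* The excess [t / 2 ^+ n * S] drops below [e] as soon as [n] exceeds [t * S / e], because
   [n < 2 ^ n]. *)
have [n hne] : exists n : nat, t * S / e < n%:R.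
  by exists (Num.truncn (t * S / e)).+1; rewrite truncnS_gt.
apply: le_trans (hL n) _; rewrite mulrDl mul1r lerD2l.
rewrite mulrAC ler_pdivrMr ?exprn_gt0//.
rewrite ltr_pdivrMr// in hne; apply: le_trans (ltW hne) _.
rewrite mulrC ler_wpM2l ?(ltW e0)// -natrX ler_nat ltnW// ltn_expl//.
Qed.

End Positive.
End Interpolation.

(** * Passage to the limit: weights that may vanish *)

Section Limit.
Import numFieldNormedType.Exports.
Local Open Scope classical_set_scope.
Local Open Scope ring_scope.
Variable R : realType.
Local Notation C := R[i].
Implicit Types (x s e : R).

Definition unzero e x : R := if x == 0 then e else x.

Lemma unzero_gt0 e x : 0 < e -> 0 <= x -> 0 < unzero e x.
Proof. by rewrite /unzero; case: (ltgtP x 0). Qed.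

Lemma cvg_powR_unzero x s : 0 < s ->
  unzero e x `^ s @[e --> 0^'+] --> x `^ s.
Proof.
rewrite /unzero => s0; have [->|_] := eqVneq x 0; last exact: cvg_cst.
by rewrite powR0 ?gt_eqF//; exact: powR_cvg0.
Qed.

(** Replacing the zeros of [a'] and [b'] by [e > 0] enlarges these weights, so both dominations
    persist and the positive case applies; then [e] tends to 0 from the right. *)
Lemma dominated_wmean (K I : finType) (T : K -> I -> C)
    (a b : K -> R) (a' b' : I -> R) s :
  (forall k, 0 <= a k) -> (forall k, 0 <= b k) ->
  (forall i, 0 <= a' i) -> (forall i, 0 <= b' i) ->
  dominated T a a' -> dominated T b b' -> 0 < s < 1 ->
  dominated T (fun k => wmean s (a k) (b k)) (fun i => wmean s (a' i) (b' i)).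
Proof.
move=> a0 b0 a'0 b'0 ha hb /andP[s0 s1] x.
have hlim : \sum_i wmean s (unzero e (a' i)) (unzero e (b' i)) * sqmod (x i)
    @[e --> 0^'+] --> \sum_i wmean s (a' i) (b' i) * sqmod (x i).
  apply: cvg_big => [|i _]; first exact: add_continuous.
  apply: cvgM; last exact: cvg_cst.
  by apply: cvgM; apply: cvg_powR_unzero; rewrite ?subr_gt0.
apply: (cvgr_to_ge hlim).
near=> e; have e0 : 0 < e by near: e; exact: nbhs_right_gt.
have le_un y : y <= unzero e y.
  by rewrite /unzero; case: eqP => // ->; exact: ltW.
by apply: dominated_wmean_pos => //; do ?[
  by move=> i; apply: unzero_gt0 | exact: dominated_le ha | exact: dominated_le hb
  | by rewrite !ltW].
Unshelve. all: by end_near.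
Qed.
End Limit.

(** * The interpolated trace inequality for a family of linear maps *)

Section TraceInequality.
Variable R : realType.
Local Notation C := R[i].

Lemma spow_powR (x s : R) : 0 < s -> spow x s = x `^ s.
Proof. by move=> s0; rewrite /spow; case: eqP => // ->; rewrite powR0 ?gt_eqF. Qed.

Lemma spectral_pair n (A : 'M[C]_n) :
  psd A -> exists Ud, spectral A Ud.1 Ud.2 /\ forall i, 0 <= Ud.2 i.
Proof.
move=> hA; have [U [d hU]] := spectral_exists hA.1; exists (U, d); split=> //=.
exact: spectral_ge0 hA hU.
Qed.

Lemma big_triple (V : zmodType) (I J L : finType) (F : I -> J -> L -> V) :
  \sum_i \sum_j \sum_l F i j l = \sum_k F k.1 k.2.1 k.2.2.
Proof.
rewrite -(pair_bigA _ (fun i p => F i p.1 p.2)) /=.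
by apply: eq_bigr => i _; rewrite (pair_bigA _ (F i)).
Qed.

(* In eigenbases of the four arguments the traces become weighted squared
   l2-norms, and the claim becomes interpolation between two weights. *)
Lemma mxtrace_wmean_le k n m (rho sigma : 'I_k -> 'M[C]_n)
    (rho' sigma' : 'M[C]_m) (Phi : 'I_k -> {linear 'M[C]_m -> 'M[C]_n}) s :
  0 < s < 1 -> (forall j, psd (rho j)) -> (forall j, psd (sigma j)) ->
  psd rho' -> psd sigma' ->
  (forall X, \sum_j complex.Re (\tr (adjmx (Phi j X) *m rho j *m Phi j X)) <=
     complex.Re (\tr (adjmx X *m rho' *m X))) ->
  (forall X, \sum_j complex.Re (\tr (adjmx (Phi j X) *m Phi j X *m sigma j)) <=
     complex.Re (\tr (adjmx X *m X *m sigma'))) ->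
  forall X, \sum_j complex.Re (\tr (adjmx (Phi j X) *m mpow (rho j) s *m
       Phi j X *m mpow (sigma j) (1 - s))) <=
     complex.Re (\tr (adjmx X *m mpow rho' s *m X *m mpow sigma' (1 - s))).
Proof.
move=> /andP[s0 s1] prho psig prho' psig' hl hr X.
have /choice[Ud hUd] j := spectral_pair (prho j).
have /choice[We hWe] j := spectral_pair (psig j).
have [[U' d'] /= [hU' d'0]] := spectral_pair prho'.
have [[W' e'] /= [hW' e'0]] := spectral_pair psig'.
have uU j : unitary (Ud j).1 := (hUd j).1.1.
have uW j : unitary (We j).1 := (hWe j).1.1.
have uU' : unitary U' := hU'.1.
have uW' : unitary W' := hW'.1.
pose mk (x : 'I_m * 'I_m -> C) := U' *m (\matrix_(i, j) x (i, j)) *m adjmx W'.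
(* The matrix of all the maps [Phi j] at once, from coordinates in the eigenbases of [rho'] and
   [sigma'] to coordinates in those of [rho j] and [sigma j]. The family index is part of the output
   index. *)
pose T (q : 'I_k * ('I_n * 'I_n)) (p : 'I_m * 'I_m) : C :=
  (adjmx (Ud q.1).1 *m Phi q.1 (U' *m delta_mx p.1 p.2 *m adjmx W')
     *m (We q.1).1) q.2.1 q.2.2.
have hT x j i l :
    fapp T x (j, (i, l)) = (adjmx (Ud j).1 *m Phi j (mk x) *m (We j).1) i l.
  rewrite /mk [\matrix_(_, _) _]matrix_sum_delta pair_bigA /=.
  rewrite !(mulmx_sumr, mulmx_suml) linear_sum !(mulmx_sumr, mulmx_suml) summxE.
  apply: eq_bigr => -[i1 i2] _; rewrite /T /= mxE.
  rewrite -!(scalemxAr, scalemxAl) linearZ /= -!(scalemxAr, scalemxAl).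
  by rewrite !mxE mulrC.
have sumT (p q : 'I_k -> 'I_n -> R) x :
  \sum_j complex.Re (\tr (adjmx (Phi j (mk x)) *m
      ((Ud j).1 *m cdiag (p j) *m adjmx (Ud j).1) *m Phi j (mk x) *m
      ((We j).1 *m cdiag (q j) *m adjmx (We j).1))) =
  \sum_t p t.1 t.2.1 * q t.1 t.2.2 * sqmod (fapp T x t).
  under eq_bigr do rewrite mxtrace_spectral//=.
  rewrite (big_triple (fun j i l => p j i * q j l *
     sqmod ((adjmx (Ud j).1 *m Phi j (mk x) *m (We j).1) i l))).
  by apply: eq_bigr => -[j [i l]] _; rewrite hT.
have sum' (p q : 'I_m -> R) x :
  complex.Re (\tr (adjmx (mk x) *m (U' *m cdiag p *m adjmx U') *m mk x *m
      (W' *m cdiag q *m adjmx W'))) =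
  \sum_t p t.1 * q t.2 * sqmod (x t).
  rewrite mxtrace_spectral//= pair_bigA; apply: eq_bigr => -[i j] _ /=.
  rewrite /mk !mulmxA uU' mul1mx -mulmxA uW' mulmx1 mxE.
  by [].
have hone j : (We j).1 *m cdiag (fun=> 1) *m adjmx (We j).1 = 1%:M.
  by rewrite cdiag1 mulmx1 unitary_mulV.
have hone' j : (Ud j).1 *m cdiag (fun=> 1) *m adjmx (Ud j).1 = 1%:M.
  by rewrite cdiag1 mulmx1 unitary_mulV.
have h1 : W' *m cdiag (fun=> 1) *m adjmx W' = 1%:M.
  by rewrite cdiag1 mulmx1 unitary_mulV.
have h1' : U' *m cdiag (fun=> 1) *m adjmx U' = 1%:M.
  by rewrite cdiag1 mulmx1 unitary_mulV.
(* The two endpoint weights: one of the two matrices in each trace is the identity, written as a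
   constant diagonal in the relevant eigenbasis. *)
have doml : dominated T (fun t => (Ud t.1).2 t.2.1) (fun t => d' t.1).
  move=> x; have := hl (mk x).
  have := sum' d' (fun=> 1) x; rewrite h1 mulmx1 -hU'.2 => ->.
  have := sumT (fun j => (Ud j).2) (fun _ _ => 1) x.
  under eq_bigr do rewrite hone mulmx1 -(hUd _).1.2.
  move=> ->.
  under eq_bigr do rewrite mulr1.
  by under [leRHS]eq_bigr do rewrite mulr1.
have domr : dominated T (fun t => (We t.1).2 t.2.2) (fun t => e' t.2).
  move=> x; have := hr (mk x).
  have := sum' (fun=> 1) e' x; rewrite h1' mulmx1 -hW'.2 => ->.
  have := sumT (fun _ _ => 1) (fun j => (We j).2) x.
  under eq_bigr do rewrite hone' mulmx1 -(hWe _).1.2.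
  move=> ->.
  under eq_bigr do rewrite mul1r.
  by under [leRHS]eq_bigr do rewrite mul1r.
have s01 : 0 < s < 1 by rewrite s0.
have s1' : 0 < 1 - s by rewrite subr_gt0.
pose x (p : 'I_m * 'I_m) := (adjmx U' *m X *m W') p.1 p.2.
have -> : X = mk x.
  have -> : X = U' *m (adjmx U' *m X *m W') *m adjmx W'.
    rewrite !mulmxA unitary_mulV// mul1mx -mulmxA unitary_mulV// mulmx1.
    by [].
  by congr (_ *m _ *m _); apply/matrixP => i j; rewrite [RHS]mxE.
have := dominated_wmean _ _ _ _ doml domr s01 x.
rewrite (mpow_spectral _ hU') (mpow_spectral _ hW') sum'.
under eq_bigr do rewrite (mpow_spectral s (hUd _).1) (mpow_spectral (1 - s) (hWe _).1).
rewrite (sumT (fun j i => spow ((Ud j).2 i) s) (fun j i => spow ((We j).2 i) (1 - s))).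
(* Both exponents [s] and [1 - s] are positive, so powers on the support agree with [powR]. *)
under [in X in _ -> X <= _]eq_bigr do rewrite !spow_powR//.
under [in X in _ -> _ <= X]eq_bigr do rewrite !spow_powR//.
by apply=> // -[j [i l]]; [exact: (hUd _).2 | exact: (hWe _).2].
Qed.

End TraceInequality.

(** * Completely positive maps, their duals and Kadison-Schwarz inequalities *)

Section CompletelyPositive.
Variable R : realType.
Local Notation C := R[i].

Lemma psd_congr n m (A : 'M[C]_n) (G : 'M[C]_(n, m)) :
  psd A -> psd (adjmx G *m A *m G).
Proof.
move=> [hA pA]; split; first by rewrite /hermitian !adjmxM adjmxK hA mulmxA.
by move=> v; have := pA (G *m v); rewrite adjmxM !mulmxA.
Qed.

Lemma psd_mxtrace_ge0 n (A : 'M[C]_n) : psd A -> 0 <= \tr A.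
Proof.
move=> hA; have [U [d hU]] := spectral_exists hA.1.
rewrite hU.2 mxtrace_cdiag; last exact: hU.1.
by rewrite ler0c; apply: sumr_ge0 => i _; exact: spectral_ge0 hA hU i.
Qed.

Lemma psd1 n : psd (1%:M : 'M[C]_n).
Proof.
apply: (@spectral_psd _ _ _ 1%:M (fun=> 1)); last by [].
by split; rewrite /unitary ?cdiag1 adjmx1 !mulmx1.
Qed.

Lemma big_mxtens_index (V : zmodType) k m (F : 'I_(k * m) -> V) :
  \sum_p F p = \sum_i \sum_a F (mxtens_index (i, a)).
Proof.
rewrite pair_bigA /= (reindex (@mxtens_index k m)) /=.
  by apply: eq_bigr => -[].
exists (@mxtens_unindex k m) => p _; [exact: mxtens_indexK | exact: mxtens_unindexK].
Qed.

Lemma amplE k n m (E : 'M[C]_n -> 'M[C]_m) (X : 'M[C]_(k * n)) i j a b :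
  ampl E X (mxtens_index (i, a)) (mxtens_index (j, b)) = E (mxblock X i j) a b.
Proof.
rewrite /ampl summxE (bigD1 i)//= summxE (bigD1 j)//= tensmxE mxE !eqxx mul1r.
rewrite big1 ?addr0 => [|l lj]; last first.
  by rewrite tensmxE mxE eqxx eq_sym (negbTE lj) mul0r.
rewrite big1 ?addr0// => l li; rewrite summxE big1// => l' _.
by rewrite tensmxE mxE eq_sym (negbTE li) mul0r.
Qed.

Section Map.
Variables (n m : nat) (E : {linear 'M[C]_n -> 'M[C]_m}).
Hypothesis cpE : completely_positive E.

Section Block.
Variables (k : nat) (rho : 'M[C]_n) (Z : 'I_k -> 'M[C]_n).
Hypothesis prho : psd rho.

(** The block row formed by the [Z i]; the blocks of the positive matrix [B] are then
    [adjmx (Z i) *m rho *m Z j]. *)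
Let G : 'M[C]_(n, k * n) :=
  \matrix_(a, p) Z (mxtens_unindex p).1 a (mxtens_unindex p).2.
Let B := adjmx G *m rho *m G.

Let blockB i j : mxblock B i j = adjmx (Z i) *m rho *m Z j.
Proof.
apply/matrixP => a b; rewrite mxE /B !mxE; apply: eq_bigr => c _.
rewrite !mxE mxtens_indexK; congr (_ * _); apply: eq_bigr => d _.
by rewrite !mxE mxtens_indexK.
Qed.

Let psdB : psd (ampl E B) := cpE (psd_congr G prho).

Lemma cp_adj i j :
  adjmx (E (adjmx (Z i) *m rho *m Z j)) = E (adjmx (Z j) *m rho *m Z i).
Proof.
rewrite -!blockB; apply/matrixP => a b; rewrite adjmxE -!amplE.
by rewrite -[in RHS]psdB.1 adjmxE.
Qed.

(** Positivity of the amplified block matrix, compressed by the block column [H] of the [W i]: the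
    trace of the compression is the double sum. *)
Lemma cp_form p (W : 'I_k -> 'M[C]_(m, p)) :
  0 <= \sum_i \sum_j \tr (adjmx (W i) *m E (adjmx (Z i) *m rho *m Z j) *m W j).
Proof.
pose H : 'M[C]_(k * m, p) :=
  \matrix_(q, c) W (mxtens_unindex q).1 (mxtens_unindex q).2 c.
suff -> : \sum_i \sum_j \tr (adjmx (W i) *m E (adjmx (Z i) *m rho *m Z j) *m W j)
    = \tr (adjmx H *m ampl E B *m H) by exact/psd_mxtrace_ge0/psd_congr.
rewrite exchange_big.
under eq_bigr do rewrite -raddf_sum -mulmx_suml.
rewrite -raddf_sum; congr (\tr _); apply/matrixP => c d.
rewrite summxE [RHS]mxE big_mxtens_index; apply: eq_bigr => j _.
rewrite mxE; apply: eq_bigr => b _; congr (_ * _); last by rewrite mxE mxtens_indexK.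
rewrite summxE mxE big_mxtens_index; apply: eq_bigr => i _.
by rewrite mxE; apply: eq_bigr => a _; rewrite amplE blockB !mxE mxtens_indexK.
Qed.

End Block.

Lemma cp_form2 p rho (Z0 Z1 : 'M[C]_n) (W0 W1 : 'M[C]_(m, p)) : psd rho ->
  0 <= \tr (adjmx W0 *m E (adjmx Z0 *m rho *m Z0) *m W0)
     + \tr (adjmx W0 *m E (adjmx Z0 *m rho *m Z1) *m W1)
     + (\tr (adjmx W1 *m E (adjmx Z1 *m rho *m Z0) *m W0)
     + \tr (adjmx W1 *m E (adjmx Z1 *m rho *m Z1) *m W1)).
Proof.
move=> prho.
have := cp_form (fun i : 'I_2 => if val i is 0%N then Z0 else Z1) prho
  (fun i : 'I_2 => if val i is 0%N then W0 else W1).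
by do 3 rewrite big_ord_recl big_ord1.
Qed.

Lemma cp_adjmx Y : adjmx (E Y) = E (adjmx Y).
Proof.
(* With [rho] the identity and the blocks 1 and [Y], the off-diagonal entries are [E Y] and
   [E (adjmx Y)]. *)
have := cp_adj (fun b : 'I_2 => if b == 0 then 1%:M else Y) (psd1 n) 0 1.
by rewrite /= adjmx1 !mulmx1 mul1mx.
Qed.

Lemma cp_psd rho : psd rho -> psd (E rho).
Proof.
move=> prho; split; first by rewrite /hermitian cp_adjmx prho.1.
move=> v; have := @cp_form 1 rho (fun=> 1%:M) prho 1 (fun=> v).
by rewrite !big_ord1 adjmx1 mul1mx mulmx1 /mxtrace big_ord1.
Qed.

(** The dual of [E] for the bilinear trace pairing. The indices of [delta_mx] are swapped because
    pairing with [delta_mx j i] extracts the entry (i, j). *)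
Definition dualmap (X : 'M[C]_m) : 'M[C]_n :=
  \matrix_(i, j) \tr (E (delta_mx j i) *m X).

Lemma dualmap_is_linear : linear dualmap.
Proof.
move=> c X Y; apply/matrixP => i j.
by rewrite !mxE mulmxDr -scalemxAr linearD linearZ.
Qed.

HB.instance Definition _ :=
  GRing.isLinear.Build C 'M[C]_m 'M[C]_n _ dualmap dualmap_is_linear.

Lemma mxtrace_dualmap Y X : \tr (Y *m dualmap X) = \tr (E Y *m X).
Proof.
rewrite {2}[Y]matrix_sum_delta linear_sum mulmx_suml raddf_sum; apply: eq_bigr => i _.
rewrite linear_sum mulmx_suml raddf_sum mxE; apply: eq_bigr => j _.
by rewrite linearZ -scalemxAl /= mxtraceZ mxE.
Qed.

Lemma dualmap_adj X : adjmx (dualmap X) = dualmap (adjmx X).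
Proof.
apply/matrixP => i j; rewrite adjmxE !mxE -mxtrace_adj adjmxM cp_adjmx.
rewrite mxtrace_mulC; congr (\tr (E _ *m _)).
by apply/matrixP => a b; rewrite !mxE andbC; case: (_ && _); rewrite /= oppr0.
Qed.

Hypothesis tpE : trace_preserving E.

(** Unitality of the dual is trace preservation of [E]. *)
Lemma dualmap1 : dualmap 1%:M = 1%:M.
Proof.
apply/matrixP => i j; rewrite !mxE mulmx1 tpE /mxtrace (bigD1 j)//= big1.
  by rewrite mxE eqxx addr0 eq_sym.
by move=> a aj; rewrite mxE (negbTE aj).
Qed.

(* Kadison-Schwarz in trace form: positivity of E on the block matrix
   (1 Z)^* rho (1 Z), tested against (X, -1), where Z = dualmap X. *)
Lemma dualmap_schwarz rho X : psd rho ->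
  complex.Re (\tr (adjmx (dualmap X) *m rho *m dualmap X)) <=
  complex.Re (\tr (adjmx X *m E rho *m X)).
Proof.
move=> prho; set Z := dualmap X.
have := cp_form2 1%:M Z X (- 1%:M) prho.
rewrite adjmx1 !mul1mx !mulmx1.
have -> : adjmx (- 1%:M : 'M[C]_m) = - 1%:M.
  by rewrite -scaleN1r adjmxZ adjmx1 rmorphN1.
rewrite !(mulmxN, mulNmx) !mulmx1 !mul1mx !raddfN /= opprK.
(* Trace preservation for the last term and duality for the two cross terms give
   [\tr (adjmx Z *m rho *m Z)] each time, so a single copy with a minus sign remains. *)
rewrite tpE -mxtrace_dualmap -/Z.
have -> : \tr (adjmx X *m E (rho *m Z)) = \tr (adjmx Z *m rho *m Z).
  rewrite mxtrace_mulC -mxtrace_dualmap -dualmap_adj -/Z.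
  by rewrite mxtrace_mulC mulmxA.
rewrite lecE => /andP[_].
case: (\tr _) (\tr _) => [a b] [c d]; simpc => /=; lra.
Qed.

Lemma dualmap_schwarz_r sigma X : psd sigma ->
  complex.Re (\tr (adjmx (dualmap X) *m dualmap X *m sigma)) <=
  complex.Re (\tr (adjmx X *m X *m E sigma)).
Proof.
move=> /(dualmap_schwarz (adjmx X)); rewrite -dualmap_adj !adjmxK.
by rewrite mxtrace_mulC mulmxA [X in _ <= complex.Re X -> _]mxtrace_mulC mulmxA.
Qed.

(** The interpolated inequality for the single map [dualmap], evaluated at the identity, which the
    dual fixes. *)
Lemma cptp_mxtrace_le rho sigma s : 0 < s < 1 -> psd rho -> psd sigma ->
  complex.Re (\tr (mpow rho s *m mpow sigma (1 - s))) <=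
  complex.Re (\tr (mpow (E rho) s *m mpow (E sigma) (1 - s))).
Proof.
move=> hs prho psig.
have := @mxtrace_wmean_le R 1 n m (fun=> rho) (fun=> sigma) (E rho) (E sigma)
  (fun=> dualmap : {linear 'M[C]_m -> 'M[C]_n}) s hs (fun=> prho) (fun=> psig)
  (cp_psd prho) (cp_psd psig) _ _ 1%:M.
rewrite big_ord1 /= dualmap1 !adjmx1 !mul1mx !mulmx1; apply=> X.
  by rewrite big_ord1; exact: dualmap_schwarz.
by rewrite big_ord1; exact: dualmap_schwarz_r.
Qed.

End Map.
End CompletelyPositive.

(** * Relative entropy with respect to the midpoint state *)

Section Entropy.
Variable R : realType.
Local Notation C := R[i].
Implicit Types a b x y : R.

Definition qtrace n a (rho sigma : 'M[C]_n) : R :=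
  complex.Re (\tr (mpow rho a *m mpow sigma (1 - a))).

Definition midpoint n (rho sigma : 'M[C]_n) : 'M[C]_n :=
  (2%:R : C)^-1 *: (rho + sigma).

(** A deformation of the negative logarithm, which is its limit as [b] tends to 0. On positive reals
    it is decreasing, and convex when [b <= 1]. *)
Definition deflog b x : R := (1 - x `^ b) / b.

Lemma DabE n a b (rho sigma : 'M[C]_n) :
  Dab a b rho sigma = deflog b (qtrace a rho sigma) / (1 - a).
Proof. by rewrite /Dab invfM mulrA mulrAC. Qed.

Lemma Jab'E n a b (rho sigma : 'M[C]_n) : Jab' a b rho sigma =
  (Dab a b rho (midpoint rho sigma) + Dab a b sigma (midpoint rho sigma)) / 2.
Proof. by []. Qed.

Lemma midpointC n (rho sigma : 'M[C]_n) : midpoint rho sigma = midpoint sigma rho.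
Proof. by rewrite /midpoint addrC. Qed.

Lemma deflog1 b : deflog b 1 = 0.
Proof. by rewrite /deflog powR1 subrr mul0r. Qed.

Lemma deflog_eq0 b x : b != 0 -> 0 < x -> deflog b x = 0 -> x = 1.
Proof.
move=> b0 x0 /eqP; rewrite mulf_eq0 invr_eq0 (negbTE b0) orbF subr_eq0 eq_sym.
by rewrite powR_eq1 (negbTE b0) ltNge (ltW x0) !orbF => /eqP.
Qed.

Lemma deflog_le b x y : b != 0 -> 0 < x -> x <= y -> deflog b y <= deflog b x.
Proof.
move=> b0 x0 xy; have y0 := lt_le_trans x0 xy; rewrite /deflog.
case: (ltgtP b 0) b0 => // bs _; last first.
  rewrite ler_pM2r ?invr_gt0// lerD2l lerN2.
  by rewrite ge0_ler_powR ?nnegrE ?(ltW x0) ?(ltW y0) ?(ltW bs).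
rewrite ler_nM2r ?invr_lt0// lerD2l lerN2 -[b]opprK (powRN x) (powRN y).
rewrite lef_pV2 ?posrE ?powR_gt0// ge0_ler_powR ?nnegrE ?(ltW x0) ?(ltW y0)//.
by rewrite oppr_ge0 ltW.
Qed.

Lemma deflog_tangent b x y : b != 0 -> b <= 1 -> 0 < x -> 0 < y ->
  deflog b y - y `^ (b - 1) * (x - y) <= deflog b x.
Proof.
move=> b0 b1 x0 y0.
have yn : y != 0 by rewrite gt_eqF.
have hy : y `^ (b - 1) * y = y `^ b.
  by rewrite -{2}(powRr1 (ltW y0)) -powRD ?subrK// yn implybT.
have hx : y `^ (b - 1) * wmean b x y = x `^ b.
  rewrite /wmean mulrCA -powRD ?yn ?implybT//.
  by rewrite [_ + _](_ : _ = 0) ?powRr0 ?mulr1//; ring.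
have t0 : 0 < y `^ (b - 1) by rewrite powR_gt0.
rewrite /deflog lerBlDr.
case: (ltgtP b 0) b0 => // bs _; last first.
  rewrite ler_pdivrMr// mulrDl mulfVK ?gt_eqF//.
  have : wmean b x y <= b * x + (1 - b) * y.
    move: b1; rewrite le_eqVlt => /predU1P[->|b1].
      by rewrite wmean1 ?(ltW x0)//; lra.
    by rewrite wmean_le ?bs ?(ltW x0) ?(ltW y0).
  rewrite -(ler_pM2l t0) hx -hy; lra.
rewrite ler_ndivrMr// mulrDl mulfVK ?lt_eqF//.
have : b * x + (1 - b) * y <= wmean b x y.
  rewrite wmeanC; have -> : b * x + (1 - b) * y = (1 - b) * y + (1 - (1 - b)) * x by ring.
  by apply: wmean_ge => //; [lra | exact: ltW].
rewrite -(ler_pM2l t0) hx -hy; lra.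
Qed.

Lemma deflog_convex k b (p q : 'I_k -> R) : b != 0 -> b <= 1 ->
  (forall j, 0 <= p j) -> \sum_j p j = 1 -> (forall j, 0 < q j) ->
  0 < \sum_j p j * q j /\
  deflog b (\sum_j p j * q j) <= \sum_j p j * deflog b (q j).
Proof.
move=> b0 b1 p0 p1 q0; set m := \sum_j p j * q j.
have m0 : 0 < m.
  rewrite lt_def sumr_ge0 ?andbT => [|j _]; last by rewrite mulr_ge0// ltW.
  apply/eqP => /psumr_eq0P h.
  have /eqP : (1 : R) = 0.
    rewrite -p1 big1// => j _; apply/eqP.
    have /eqP := h (fun j _ => mulr_ge0 (p0 j) (ltW (q0 j))) j isT.
    by rewrite mulf_eq0 (gt_eqF (q0 j)) orbF.
  by rewrite oner_eq0.
split=> //.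
(* Jensen through the tangent at the mean [m]: the linear terms average to zero. *)
apply: (@le_trans _ _ (\sum_j p j * (deflog b m - m `^ (b - 1) * (q j - m)))).
  set D := deflog b m; set t := m `^ (b - 1).
  have e j : p j * (D - t * (q j - m)) = (D + t * m) * p j - t * (p j * q j) by ring.
  under eq_bigr do rewrite e.
  by rewrite sumrB -!mulr_sumr p1 mulr1 addrK.
by apply: ler_sum => j _; rewrite ler_wpM2l// deflog_tangent.
Qed.

Lemma psdD n (A B : 'M[C]_n) : psd A -> psd B -> psd (A + B).
Proof.
move=> [hA pA] [hB pB]; split; first by rewrite /hermitian adjmxD hA hB.
by move=> v; rewrite mulmxDr mulmxDl mxE addr_ge0.
Qed.

Lemma psdZ n (c : R) (A : 'M[C]_n) : 0 <= c -> psd A -> psd (c%:C *: A).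
Proof.
move=> c0 [hA pA]; split; first by rewrite /hermitian adjmxZ conjc_real hA.
by move=> v; rewrite -scalemxAr -scalemxAl mxE mulr_ge0// ler0c.
Qed.

Lemma density_convex n k (p : 'I_k -> R) (rho : 'I_k -> 'M[C]_n) :
  (forall j, 0 <= p j) -> \sum_j p j = 1 -> (forall j, density (rho j)) ->
  density (\sum_j (p j)%:C *: rho j).
Proof.
move=> p0 p1 hrho; split.
  apply: (big_ind (@psd R n)) => [|A B|j _]; last by apply: psdZ => //; case: (hrho j).
    split=> [|v]; first by rewrite /hermitian /adjmx map_mx0 trmx0.
    by rewrite mulmx0 mul0mx mxE.
  exact: psdD.
rewrite raddf_sum -(rmorph1 (real_complex R)) -p1 rmorph_sum.
by apply: eq_bigr => j _; rewrite /= mxtraceZ (hrho j).2 mulr1.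
Qed.

Lemma half_real : (2%:R : C)^-1 = (2^-1)%:C.
Proof. by rewrite fmorphV rmorph_nat. Qed.

Lemma density_midpoint n (rho sigma : 'M[C]_n) :
  density rho -> density sigma -> density (midpoint rho sigma).
Proof.
move=> [pr tr] [ps ts]; split.
  by rewrite /midpoint half_real; apply: psdZ; rewrite ?invr_ge0//; exact: psdD.
by rewrite /midpoint mxtraceZ mxtraceD tr ts -mulr2n mulVf// pnatr_eq0.
Qed.

(** Under this vanishing the overlap matrix intertwines the two diagonals, so both decompositions
    give the same matrix. *)
Lemma spectral_eq n (A B U W : 'M[C]_n) d e :
  spectral A U d -> spectral B W e ->
  (forall i j, d i != e j -> (adjmx U *m W) i j = 0) -> A = B.
Proof.
move=> [hU hA] [hW hB] h.
have hc : cdiag d *m (adjmx U *m W) = (adjmx U *m W) *m cdiag e.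
  move: (adjmx U *m W) h => M h; apply/matrixP => i j.
  rewrite mul_diag_mx mul_mx_diag !mxE.
  have [->|/h ->] := eqVneq (d i) (e j); first by rewrite mulrC.
  by rewrite mulr0 mul0r.
rewrite hA -[LHS]mulmx1 -(unitary_mulV hW) !mulmxA.
rewrite -(mulmxA _ (adjmx U) W) -(mulmxA U) hc !mulmxA.
by rewrite unitary_mulV// mul1mx hB.
Qed.

Section Overlap.
Variables (n : nat) (rho tau U W : 'M[C]_n) (d e : 'I_n -> R) (a : R).
Hypotheses (drho : density rho) (dtau : density tau).
Hypotheses (hU : spectral rho U d) (hW : spectral tau W e).
Let c i j := sqmod ((adjmx U *m W) i j).
(** The inclusion of the support of [rho] in that of [tau], read on the overlaps. *)
Hypothesis supp : forall i j, e j = 0 -> d i * c i j = 0.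
Hypothesis a0 : 0 < a.

Let d0 i : 0 <= d i := spectral_ge0 drho.1 hU i.
Let e0 i : 0 <= e i := spectral_ge0 dtau.1 hW i.
Let c0 i j : 0 <= c i j := sqmod_ge0 _.

Let overlapE (p q : 'I_n -> R) :
  complex.Re (\tr ((U *m cdiag p *m adjmx U) *m (W *m cdiag q *m adjmx W))) =
  \sum_i \sum_j p i * q j * c i j.
Proof.
have := mxtrace_spectral p q 1%:M hU.1 hW.1.
by rewrite adjmx1 mul1mx !mulmx1 => ->.
Qed.

Let suml : \sum_i \sum_j d i * c i j = 1.
Proof.
have := overlapE d (fun=> 1).
rewrite cdiag1 mulmx1 (unitary_mulV hW.1) mulmx1 -hU.2 drho.2 => h.
rewrite -[RHS]/(complex.Re (1 : C)) h.
by apply: eq_bigr => i _; apply: eq_bigr => j _; rewrite mulr1.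
Qed.

Let sumr : \sum_i \sum_j e j * c i j = 1.
Proof.
have := overlapE (fun=> 1) e.
rewrite cdiag1 mulmx1 (unitary_mulV hU.1) mul1mx -hW.2 dtau.2 => h.
rewrite -[RHS]/(complex.Re (1 : C)) h.
by apply: eq_bigr => i _; apply: eq_bigr => j _; rewrite mul1r.
Qed.

(** The arithmetic means have total 1, so a termwise comparison with geometric means compares
    [qtrace] with 1. *)
Let sum_affine : \sum_i \sum_j (a * d i + (1 - a) * e j) * c i j = 1.
Proof.
transitivity (a * (\sum_i \sum_j d i * c i j) +
  (1 - a) * (\sum_i \sum_j e j * c i j)); last by rewrite suml sumr !mulr1 subrKC.
rewrite !mulr_sumr -big_split; apply: eq_bigr => i _.
rewrite !mulr_sumr -big_split; apply: eq_bigr => j _ /=.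
by rewrite mulrDl !mulrA.
Qed.

Let qE : qtrace a rho tau =
  \sum_i \sum_j spow (d i) a * spow (e j) (1 - a) * c i j.
Proof. by rewrite /qtrace (mpow_spectral _ hU) (mpow_spectral _ hW) overlapE. Qed.

(** Equal sums of ordered terms are equal termwise; strictness then makes eigenvectors with distinct
    eigenvalues orthogonal, and [spectral_eq] applies. *)
Let eq_of_pairs (F G : 'I_n -> 'I_n -> R) :
  (forall i j, F i j <= G i j) -> \sum_i \sum_j F i j = \sum_i \sum_j G i j ->
  (forall i j, d i != e j -> F i j = G i j -> c i j = 0) -> rho = tau.
Proof.
move=> FG sFG h; apply: (spectral_eq hU hW) => i j dij.
apply/eqP; rewrite -sqmod_eq0; apply/eqP/(h i j dij)/esym/eqP.
rewrite -subr_eq0.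
have hz : \sum_i (\sum_j (G i j - F i j)) = 0.
  by under eq_bigr do rewrite sumrB; rewrite sumrB sFG subrr.
have GF i' j' : true -> 0 <= G i' j' - F i' j' by rewrite subr_ge0.
have hi : \sum_j (G i j - F i j) = 0.
  exact: (psumr_eq0P (fun i _ => sumr_ge0 _ (GF i)) hz).
by apply/eqP; exact: (psumr_eq0P (GF i) hi).
Qed.

Lemma qtrace_lt1 : a < 1 ->
  [/\ 0 < qtrace a rho tau, qtrace a rho tau <= 1
    & qtrace a rho tau = 1 -> rho = tau].
Proof.
move=> a1; have a1' : 0 < 1 - a by rewrite subr_gt0.
have ha : 0 < a < 1 by rewrite a0.
have hq : qtrace a rho tau = \sum_i \sum_j wmean a (d i) (e j) * c i j.
  by rewrite qE; apply: eq_bigr => i _; apply: eq_bigr => j _; rewrite !spow_powR.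
have le_term i j : wmean a (d i) (e j) * c i j <= (a * d i + (1 - a) * e j) * c i j.
  by rewrite ler_wpM2r// wmean_le.
split; rewrite hq.
- rewrite lt_def sumr_ge0 ?andbT => [|i _]; last first.
    by apply: sumr_ge0 => j _; rewrite mulr_ge0 ?wmean_ge0.
  have w0 i j : true -> 0 <= wmean a (d i) (e j) * c i j.
    by rewrite mulr_ge0 ?wmean_ge0.
  apply/eqP => hz.
  (* If the trace vanished, each [d i * c i j] would be zero, by [supp] when [e j = 0], against
     [suml]. *)
  have /eqP : (1 : R) = 0.
    rewrite -suml big1// => i _; rewrite big1// => j _.
    have [/supp //|ej] := eqVneq (e j) 0.
    have hi : \sum_j wmean a (d i) (e j) * c i j = 0.
      exact: (psumr_eq0P (fun i _ => sumr_ge0 _ (w0 i)) hz).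
    have /eqP : wmean a (d i) (e j) * c i j = 0 by exact: (psumr_eq0P (w0 i) hi).
    rewrite /wmean !mulf_eq0 !powR_eq0 (negbTE ej) /= orbF.
    by case/orP => [/andP[/eqP -> _]|/eqP ->]; rewrite ?mul0r ?mulr0.
  by rewrite oner_eq0.
- by rewrite -sum_affine; apply: ler_sum => i _; apply: ler_sum => j _.
- rewrite -sum_affine => hs; apply: (eq_of_pairs le_term hs) => i j dij.
  have lt_ij := wmean_lt ha (d0 i) (e0 j) dij.
  by move=> /eqP; rewrite -subr_eq0 -mulrBl mulf_eq0 subr_eq0 lt_eqF//= => /eqP.
Qed.

Lemma qtrace_gt1 : 1 < a ->
  1 <= qtrace a rho tau /\ (qtrace a rho tau = 1 -> rho = tau).
Proof.
move=> a1.
have term i j : (a * d i + (1 - a) * e j) * c i j <=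
      spow (d i) a * spow (e j) (1 - a) * c i j /\
    (d i != e j -> (a * d i + (1 - a) * e j) * c i j =
      spow (d i) a * spow (e j) (1 - a) * c i j -> c i j = 0).
  (* On the kernel of [tau] the negative power is 0 by convention, and [supp] makes the affine side
     vanish too. *)
  have [ej|ej] := eqVneq (e j) 0.
    rewrite ej /spow eqxx !mulr0 addr0 -mulrA supp// mulr0 mul0r; split=> // di _.
    by have /eqP := supp i ej; rewrite mulf_eq0 (negbTE di) => /eqP.
  have ej0 : 0 < e j by rewrite lt_def ej e0.
  have -> : spow (d i) a * spow (e j) (1 - a) = wmean a (d i) (e j).
    by rewrite spow_powR// /spow (negbTE ej).
  split=> [|dij /eqP]; first by rewrite ler_wpM2r// wmean_ge.
  have lt_ij := wmean_gt a1 (d0 i) ej0 dij.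
  by rewrite -subr_eq0 -mulrBl mulf_eq0 subr_eq0 lt_eqF//= => /eqP.
rewrite qE; split.
  rewrite -[leLHS]sum_affine.
  by apply: ler_sum => i _; apply: ler_sum => j _; exact: (term i j).1.
move=> hs; apply: (eq_of_pairs _ (etrans sum_affine (esym hs))) => i j.
  exact: (term i j).1.
exact: (term i j).2.
Qed.

End Overlap.

(** A vector [v] in the kernel of the midpoint makes the sum of the nonnegative forms of [rho] and
    [sigma] zero. The form of [rho] at [v] thus vanishes, and so does each term of its expansion in
    the eigenbasis. *)
Lemma midpoint_support n (rho sigma U W : 'M[C]_n) d e :
  psd rho -> psd sigma -> spectral rho U d ->
  spectral (midpoint rho sigma) W e ->
  forall i j, e j = 0 -> d i * sqmod ((adjmx U *m W) i j) = 0.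
Proof.
move=> pr ps hU hW i j ej.
pose v : 'cV[C]_n := W *m delta_mx j 0.
have hr : (adjmx v *m rho *m v) 0 0 =
    (\sum_i d i * sqmod ((adjmx U *m W) i j))%:C.
  have -> : adjmx v *m rho *m v = adjmx (adjmx U *m v) *m cdiag d *m (adjmx U *m v).
    by rewrite {1}hU.2 adjmxM adjmxK !mulmxA.
  rewrite adj_cV_diag; congr (_%:C); apply: eq_bigr => k _; congr (_ * sqmod _).
  by rewrite /v mulmxA -colE mxE.
have hm : (adjmx v *m midpoint rho sigma *m v) 0 0 = 0.
  have -> : adjmx v *m midpoint rho sigma *m v =
      adjmx (delta_mx j 0 : 'cV[C]_n) *m cdiag e *m delta_mx j 0.
    rewrite hW.2 /v adjmxM !mulmxA -(mulmxA _ (adjmx W) W) hW.1 mulmx1.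
    by rewrite -(mulmxA _ (adjmx W) W) hW.1 mulmx1.
  rewrite adj_cV_diag big1// => k _; rewrite mxE.
  by have [->|] := eqVneq k j; rewrite ?ej ?mul0r// sqmod0 mulr0.
move: hm; rewrite /midpoint -scalemxAr -scalemxAl mxE => /eqP.
rewrite mulf_eq0 invr_eq0 pnatr_eq0 /= mulmxDr mulmxDl mxE.
rewrite paddr_eq0 ?pr.2 ?ps.2// hr => /andP[/eqP hz _].
have {}hz := @complexI R _ 0 hz.
apply: (psumr_eq0P _ hz) => // k _.
by rewrite mulr_ge0 ?sqmod_ge0// (spectral_ge0 pr hU).
Qed.

(** For [a < 1] the trace is at most 1 and [deflog] is nonnegative; for [a > 1] both [deflog] and
    [1 - a] change sign. *)
Lemma Dab_midpoint n a b (rho sigma : 'M[C]_n) :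
  0 < a -> a != 1 -> b != 0 -> density rho -> density sigma ->
  0 <= Dab a b rho (midpoint rho sigma) /\
  (Dab a b rho (midpoint rho sigma) = 0 -> rho = midpoint rho sigma).
Proof.
move=> a0 a1 b0 hr hs.
have hm := density_midpoint hr hs.
have [U [d hU]] := spectral_exists hr.1.1.
have [W [e hW]] := spectral_exists hm.1.1.
have supp := midpoint_support hr.1 hs.1 hU hW.
rewrite DabE; set q := qtrace _ _ _.
have eq0 : 0 < q -> deflog b q / (1 - a) = 0 -> q = 1.
  move=> q0 /eqP; rewrite mulf_eq0 invr_eq0 subr_eq0 [1 == a]eq_sym (negbTE a1) orbF.
  by move=> /eqP; exact: deflog_eq0.
case: (ltgtP a 1) a1 => // a1 _.
  have [q0 q1 hq] := qtrace_lt1 hr hm hU hW supp a0 a1.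
  split; last by move=> /(eq0 q0).
  by rewrite divr_ge0 ?subr_ge0 ?(ltW a1)// -(deflog1 b) deflog_le.
have [q1 hq] := qtrace_gt1 hr hm hU hW supp a0 a1.
have q0 : 0 < q by rewrite (lt_le_trans _ q1).
split; last by move=> /(eq0 q0).
by rewrite mulr_le0 ?invr_le0 ?subr_le0 ?(ltW a1)// -(deflog1 b) deflog_le.
Qed.

Lemma qtrace_midpoint_gt0 n a (rho sigma : 'M[C]_n) :
  0 < a < 1 -> density rho -> density sigma ->
  0 < qtrace a rho (midpoint rho sigma).
Proof.
move=> /andP[a0 a1] hr hs.
have hm := density_midpoint hr hs.
have [U [d hU]] := spectral_exists hr.1.1.
have [W [e hW]] := spectral_exists hm.1.1.
have supp := midpoint_support hr.1 hs.1 hU hW.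
by have [] := qtrace_lt1 hr hm hU hW supp a0 a1.
Qed.

Lemma midpoint_id n (rho sigma : 'M[C]_n) :
  rho = midpoint rho sigma -> rho = sigma.
Proof.
rewrite /midpoint => /(congr1 ( *:%R (2%:R : C))).
rewrite scalerA divff ?pnatr_eq0// scale1r scaler_nat mulr2n => /addrI.
by [].
Qed.

Lemma midpointxx n (rho : 'M[C]_n) : midpoint rho rho = rho.
Proof.
by rewrite /midpoint -mulr2n -(scaler_nat 2 rho) scalerA mulVf ?pnatr_eq0// scale1r.
Qed.

End Entropy.

(** * The six properties of the divergence *)

Section Properties.
Variable R : realType.
Local Notation C := R[i].
Implicit Types a b x y : R.

Lemma spowM x y t : 0 <= x -> 0 <= y -> spow (x * y) t = spow x t * spow y t.
Proof.
move=> x0 y0; rewrite /spow mulf_eq0.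
case: eqVneq => [_|_] /=; first by rewrite mul0r.
by case: eqVneq => [_|_] /=; rewrite ?mulr0// powRM.
Qed.

(** Serves both as the value at coinciding states and as the factor split off by a common tensor
    component. *)
Lemma mxtrace_mpow_density n a (tau : 'M[C]_n) :
  density tau -> \tr (mpow tau a *m mpow tau (1 - a)) = 1.
Proof.
move=> ht; have [U [d hU]] := spectral_exists ht.1.1.
have d0 := spectral_ge0 ht.1 hU.
have ha i : spow (d i) a * spow (d i) (1 - a) = d i.
  rewrite /spow; case: eqVneq => [->|t0]; first by rewrite mul0r.
  by rewrite -powRD ?t0 ?implybT// subrKC powRr1.
rewrite !(mpow_spectral _ hU) !mulmxA -(mulmxA _ (adjmx U) U) hU.1 mulmx1.
rewrite -(mulmxA U) mulmx_diag.
transitivity ((\sum_i d i)%:C); last by rewrite (spectral_sum1 ht hU).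
rewrite -(mxtrace_cdiag d hU.1).
congr (\tr (_ *m diag_mx _ *m _)); apply/rowP => i.
by rewrite !mxE -rmorphM /= ha.
Qed.

Lemma half_sum_ge0 x y : 0 <= x -> 0 <= y ->
  0 <= (x + y) / 2 /\ ((x + y) / 2 = 0 -> x = 0).
Proof. by move=> x0 y0; split=> [|h]; lra. Qed.

Lemma Jab'_definite n a b (rho sigma : 'M[C]_n) :
  0 < a -> a != 1 -> b != 0 -> density rho -> density sigma ->
  0 <= Jab' a b rho sigma /\ (Jab' a b rho sigma = 0 <-> rho = sigma).
Proof.
move=> a0 a1 b0 hr hs; rewrite Jab'E.
have [D1 E1] := Dab_midpoint a0 a1 b0 hr hs.
have [D2 _] := Dab_midpoint a0 a1 b0 hs hr; rewrite midpointC in D2.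
have [J0 J1] := half_sum_ge0 D1 D2.
split; first exact: J0.
(* The half-sum of two nonnegative terms vanishes only if the first does, and [rho] equal to the
   midpoint already forces [rho = sigma]. *)
split=> [/J1/E1|<-]; first exact: midpoint_id.
rewrite midpointxx DabE /qtrace mxtrace_mpow_density; last exact: hr.
by rewrite deflog1 !mul0r addr0 mul0r.
Qed.

Lemma spectral_conj n (A U V : 'M[C]_n) d :
  unitary V -> spectral A U d -> spectral (V *m A *m adjmx V) (V *m U) d.
Proof.
move=> hV [hU hA]; split; first exact: unitaryM.
by rewrite {1}hA adjmxM !mulmxA.
Qed.

Lemma mpow_conj n (A V : 'M[C]_n) t : hermitian A -> unitary V ->
  mpow (V *m A *m adjmx V) t = V *m mpow A t *m adjmx V.
Proof.
move=> hA hV; have [U [d hU]] := spectral_exists hA.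
by rewrite (mpow_spectral _ (spectral_conj hV hU)) (mpow_spectral _ hU) adjmxM !mulmxA.
Qed.

Lemma qtrace_conj n a (A B V : 'M[C]_n) : hermitian A -> hermitian B -> unitary V ->
  qtrace a (V *m A *m adjmx V) (V *m B *m adjmx V) = qtrace a A B.
Proof.
move=> hA hB hV; rewrite /qtrace !mpow_conj// !mulmxA -(mulmxA _ (adjmx V) V) hV.
by rewrite mulmx1 mxtrace_mulC !mulmxA hV mul1mx.
Qed.

Lemma Jab'_unitary n a b (rho sigma U : 'M[C]_n) :
  density rho -> density sigma -> unitary U ->
  Jab' a b (U *m rho *m adjmx U) (U *m sigma *m adjmx U) = Jab' a b rho sigma.
Proof.
move=> hr hs hU; have hm := density_midpoint hr hs; rewrite !Jab'E !DabE.
have -> : midpoint (U *m rho *m adjmx U) (U *m sigma *m adjmx U)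
    = U *m midpoint rho sigma *m adjmx U.
  by rewrite /midpoint -scalemxAr -scalemxAl mulmxDr mulmxDl.
rewrite !qtrace_conj//; [exact: hs.1.1 | exact: hm.1.1 | exact: hr.1.1 |].
exact: hm.1.1.
Qed.

Lemma mxtrace_tens m n (A : 'M[C]_m) (B : 'M[C]_n) : \tr (A *t B) = \tr A * \tr B.
Proof.
rewrite /mxtrace big_mxtens_index mulr_suml; apply: eq_bigr => i _.
by rewrite mulr_sumr; apply: eq_bigr => j _; rewrite tensmxE.
Qed.

Lemma tensmx11 m n : (1%:M : 'M[C]_m) *t (1%:M : 'M[C]_n) = 1%:M.
Proof.
apply/matrixP => p q; case: (mxtens_indexP p) => i j; case: (mxtens_indexP q) => k l.
rewrite tensmxE !mxE (inj_eq (can_inj (@mxtens_indexK m n))) xpair_eqE.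
by case: eqP; case: eqP; rewrite ?mulr1 ?mulr0 ?mul0r.
Qed.

Lemma spectral_tens m n (A U : 'M[C]_m) (B V : 'M[C]_n) d e :
  spectral A U d -> spectral B V e ->
  spectral (A *t B) (U *t V)
    (fun p => d (mxtens_unindex p).1 * e (mxtens_unindex p).2).
Proof.
move=> [hU hA] [hV hB]; split.
  by rewrite /unitary adjmx_tens tensmx_mul hU hV tensmx11.
rewrite {1}hA {1}hB -!tensmx_mul -adjmx_tens; congr (_ *m _ *m _).
apply/matrixP => p q; case: (mxtens_indexP p) => i j; case: (mxtens_indexP q) => k l.
rewrite tensmxE !cdiagE mxtens_indexK.
rewrite (inj_eq (can_inj (@mxtens_indexK m n))) xpair_eqE rmorphM.
by case: eqP; case: eqP; rewrite ?mulr1n ?mulr0n ?mulr0 ?mul0r.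
Qed.

(** In the product eigenbasis the eigenvalues are products of nonnegative reals, on which [spow] is
    multiplicative. *)
Lemma mpow_tens m n (A : 'M[C]_m) (B : 'M[C]_n) t : psd A -> psd B ->
  mpow (A *t B) t = mpow A t *t mpow B t.
Proof.
move=> pA pB.
have [U [d hU]] := spectral_exists pA.1; have [V [e hV]] := spectral_exists pB.1.
have d0 := spectral_ge0 pA hU; have e0 := spectral_ge0 pB hV.
have hUV : spectral (mpow A t *t mpow B t) (U *t V) (fun p =>
    spow (d (mxtens_unindex p).1) t * spow (e (mxtens_unindex p).2) t).
  apply: (spectral_tens (d := fun i => spow (d i) t) (e := fun i => spow (e i) t)).
    by split; [exact: hU.1 | exact: mpow_spectral].
  by split; [exact: hV.1 | exact: mpow_spectral].
rewrite hUV.2 (mpow_spectral _ (spectral_tens hU hV)); congr (_ *m diag_mx _ *m _).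
by apply/rowP => p; rewrite !mxE spowM.
Qed.

Lemma qtrace_tens m n a (A B : 'M[C]_m) (tau : 'M[C]_n) :
  psd A -> psd B -> density tau ->
  qtrace a (A *t tau) (B *t tau) = qtrace a A B.
Proof.
move=> pA pB ht; rewrite /qtrace !mpow_tens//; do ?exact: ht.1.
by rewrite tensmx_mul mxtrace_tens mxtrace_mpow_density// mulr1.
Qed.

Lemma Jab'_tens n k a b (rho sigma : 'M[C]_n) (tau : 'M[C]_k) :
  density rho -> density sigma -> density tau ->
  Jab' a b (rho *t tau) (sigma *t tau) = Jab' a b rho sigma.
Proof.
move=> hr hs ht; have hm := density_midpoint hr hs; rewrite !Jab'E !DabE.
have -> : midpoint (rho *t tau) (sigma *t tau) = midpoint rho sigma *t tau.
  by apply/matrixP => p q; rewrite !mxE -mulrDl mulrA.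
by rewrite !qtrace_tens//; [exact: hs.1 | exact: hm.1 | exact: hr.1 | exact: hm.1].
Qed.

Lemma Dab_le n m a b (rho tau : 'M[C]_n) (rho' tau' : 'M[C]_m) :
  a < 1 -> b != 0 -> 0 < qtrace a rho tau ->
  qtrace a rho tau <= qtrace a rho' tau' -> Dab a b rho' tau' <= Dab a b rho tau.
Proof.
move=> a1 b0 q0 hq; rewrite !DabE ler_pM2r ?invr_gt0 ?subr_gt0//.
exact: deflog_le.
Qed.

(** By linearity [E] maps the midpoint to the midpoint, so each term is handled separately: its
    trace is positive and grows under [E], and [deflog] is decreasing. *)
Lemma Jab'_cptp n m a b (rho sigma : 'M[C]_n) (E : {linear 'M[C]_n -> 'M[C]_m}) :
  0 < a < 1 -> b != 0 -> density rho -> density sigma -> CPTP E ->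
  Jab' a b (E rho) (E sigma) <= Jab' a b rho sigma.
Proof.
move=> ha b0 hr hs [cpE tpE]; have hm := density_midpoint hr hs; rewrite !Jab'E.
have /andP[_ a1] := ha.
have -> : midpoint (E rho) (E sigma) = E (midpoint rho sigma).
  by rewrite /midpoint -(linearD E) -(linearZ_LR E).
rewrite ler_pM2r ?invr_gt0//; apply: lerD; apply: Dab_le => //.
- exact: qtrace_midpoint_gt0.
- by apply: cptp_mxtrace_le => //; [exact: hr.1 | exact: hm.1].
- by rewrite midpointC; exact: qtrace_midpoint_gt0.
- by apply: cptp_mxtrace_le => //; [exact: hs.1 | exact: hm.1].
Qed.

Lemma mpowZ n (c : R) (A : 'M[C]_n) t : 0 <= c -> 0 < t -> psd A ->
  mpow (c%:C *: A) t = (c `^ t)%:C *: mpow A t.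
Proof.
move=> c0 t0 pA; have [U [d hU]] := spectral_exists pA.1.
have d0 := spectral_ge0 pA hU.
have cdiagZ (x : R) (f : 'I_n -> R) :
    x%:C *: (U *m cdiag f *m adjmx U) = U *m cdiag (fun i => x * f i) *m adjmx U.
  rewrite scalemxAl scalemxAr; congr (_ *m _ *m _); apply/matrixP => i j.
  by rewrite mxE !cdiagE rmorphM mulrnAr.
have hcU : spectral (c%:C *: A) U (fun i => c * d i).
  by split; [exact: hU.1 | rewrite {1}hU.2 cdiagZ].
rewrite (mpow_spectral _ hcU) (mpow_spectral _ hU) cdiagZ; congr (_ *m diag_mx _ *m _).
by apply/rowP => i; rewrite !mxE spowM// spow_powR.
Qed.

(** The interpolated inequality with every [Phi j] the identity and the weighted states [p j] times
    [rho j] and [sigma j]. Both endpoint bounds are equalities by linearity, and the weights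
    recombine as [p j] to the power [a + (1 - a)]. *)
Lemma qtrace_concave n k a (p : 'I_k -> R) (rho sigma : 'I_k -> 'M[C]_n) :
  0 < a < 1 -> (forall j, 0 <= p j) -> \sum_j p j = 1 ->
  (forall j, density (rho j)) -> (forall j, density (sigma j)) ->
  \sum_j p j * qtrace a (rho j) (sigma j) <=
  qtrace a (\sum_j (p j)%:C *: rho j) (\sum_j (p j)%:C *: sigma j).
Proof.
move=> ha p0 p1 hr hs; have /andP[a0 a1] := ha.
have a1' : 0 < 1 - a by rewrite subr_gt0.
have pr j : psd ((p j)%:C *: rho j) by apply: psdZ => //; exact: (hr j).1.
have ps j : psd ((p j)%:C *: sigma j) by apply: psdZ => //; exact: (hs j).1.
have := @mxtrace_wmean_le R k n n _ _ (\sum_j (p j)%:C *: rho j)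
  (\sum_j (p j)%:C *: sigma j) (fun=> idfun : {linear 'M[C]_n -> 'M[C]_n}) a ha pr ps
  (density_convex p0 p1 hr).1 (density_convex p0 p1 hs).1 _ _ 1%:M.
rewrite /= adjmx1 !mul1mx !mulmx1 => h; apply: le_trans (h _ _) => [|X|X].
- apply: ler_sum => j _; rewrite !mul1mx ?mulmx1.
  rewrite !mpowZ//; [|exact: (hs j).1|exact: (hr j).1].
  rewrite -scalemxAl -scalemxAr scalerA mxtraceZ -rmorphM ReZ -/(wmean a _ _).
  by rewrite wmeanxx.
- by rewrite mulmx_sumr mulmx_suml (raddf_sum (@mxtrace C n)) Re_sum.
- by rewrite mulmx_sumr (raddf_sum (@mxtrace C n)) Re_sum.
Qed.

Lemma Jab'_convex n k a b (p : 'I_k -> R) (rhos sigmas : 'I_k -> 'M[C]_n) :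
  0 < a < 1 -> b != 0 -> b <= 1 ->
  (forall j, 0 <= p j) -> \sum_(j < k) p j = 1 ->
  (forall j, density (rhos j)) -> (forall j, density (sigmas j)) ->
  Jab' a b (\sum_(j < k) (p j)%:C *: rhos j) (\sum_(j < k) (p j)%:C *: sigmas j)
    <= \sum_(j < k) p j * Jab' a b (rhos j) (sigmas j).
Proof.
move=> ha b0 b1 p0 p1 hr hs; have /andP[_ a1] := ha.
have hm j := density_midpoint (hr j) (hs j).
have -> : \sum_j p j * Jab' a b (rhos j) (sigmas j) =
   (\sum_j p j * Dab a b (rhos j) (midpoint (rhos j) (sigmas j)) +
    \sum_j p j * Dab a b (sigmas j) (midpoint (rhos j) (sigmas j))) / 2.
  rewrite -big_split /= mulr_suml; apply: eq_bigr => j _.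
  by rewrite Jab'E mulrA mulrDr.
rewrite Jab'E.
have -> : midpoint (\sum_j (p j)%:C *: rhos j) (\sum_j (p j)%:C *: sigmas j)
   = \sum_j (p j)%:C *: midpoint (rhos j) (sigmas j).
  rewrite /midpoint -big_split scaler_sumr; apply: eq_bigr => j _ /=.
  by rewrite -scalerDr !scalerA mulrC.
(* Joint concavity of the trace combines with [deflog] decreasing and convex; the claim is then used
   once for the [rhos] and once for the [sigmas], each against the midpoints. *)
have main (r t : 'I_k -> 'M[C]_n) : (forall j, density (r j)) ->
    (forall j, density (t j)) -> (forall j, 0 < qtrace a (r j) (t j)) ->
    Dab a b (\sum_j (p j)%:C *: r j) (\sum_j (p j)%:C *: t j) <=
    \sum_j p j * Dab a b (r j) (t j).
  move=> hr' ht q0; have [m0 hd] := deflog_convex b0 b1 p0 p1 q0.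
  under [leRHS]eq_bigr do rewrite DabE mulrA.
  rewrite -mulr_suml DabE ler_pM2r ?invr_gt0 ?subr_gt0//.
  apply: le_trans hd; apply: deflog_le => //; exact: qtrace_concave.
rewrite ler_pM2r ?invr_gt0//; apply: lerD; apply: main => // j.
  exact: qtrace_midpoint_gt0.
by rewrite midpointC; exact: qtrace_midpoint_gt0.
Qed.

Lemma Jab'C n a b (rho sigma : 'M[C]_n) : Jab' a b rho sigma = Jab' a b sigma rho.
Proof.
rewrite !Jab'E (midpointC sigma).
by move: (Dab a b rho _) (Dab a b sigma _) => x y; rewrite addrC.
Qed.

End Properties.

Theorem theorem2 (R : realType) :
  (* (i) nonnegativity and definiteness *)
  (forall (n : nat) (a b : R) (rho sigma : 'M[R[i]]_n),
     0 < a -> a != 1 -> b != 0 -> density rho -> density sigma ->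
     0 <= Jab' a b rho sigma /\ (Jab' a b rho sigma = 0 <-> rho = sigma)) /\
  (* (ii) invariance under tensoring with a common state *)
  (forall (n k : nat) (a b : R) (rho sigma : 'M[R[i]]_n) (tau : 'M[R[i]]_k),
     0 < a -> a != 1 -> b != 0 ->
     density rho -> density sigma -> density tau ->
     Jab' a b (rho *t tau) (sigma *t tau) = Jab' a b rho sigma) /\
  (* (iii) data processing under quantum operations *)
  (forall (n m : nat) (a b : R) (rho sigma : 'M[R[i]]_n)
          (E : {linear 'M[R[i]]_n -> 'M[R[i]]_m}),
     0 < a < 1 -> b != 0 -> b <= 1 ->
     density rho -> density sigma -> CPTP E ->
     Jab' a b (E rho) (E sigma) <= Jab' a b rho sigma) /\
  (* (iv) unitary invariance *)
  (forall (n : nat) (a b : R) (rho sigma U : 'M[R[i]]_n),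
     0 < a -> a != 1 -> b != 0 -> density rho -> density sigma -> unitary U ->
     Jab' a b (U *m rho *m adjmx U) (U *m sigma *m adjmx U)
       = Jab' a b rho sigma) /\
  (* (v) joint convexity *)
  (forall (n k : nat) (a b : R) (p : 'I_k -> R)
          (rhos sigmas : 'I_k -> 'M[R[i]]_n),
     0 < a < 1 -> b != 0 -> b <= 1 ->
     (forall j, 0 <= p j) -> \sum_(j < k) p j = 1 ->
     (forall j, density (rhos j)) -> (forall j, density (sigmas j)) ->
     Jab' a b (\sum_(j < k) (p j)%:C *: rhos j)
              (\sum_(j < k) (p j)%:C *: sigmas j)
       <= \sum_(j < k) p j * Jab' a b (rhos j) (sigmas j)) /\
  (* (vi) symmetry *)
  (forall (n : nat) (a b : R) (rho sigma : 'M[R[i]]_n),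
     0 < a -> a != 1 -> b != 0 -> density rho -> density sigma ->
     Jab' a b rho sigma = Jab' a b sigma rho).
Proof.
split; first exact: Jab'_definite.
split; first by move=> n k a b rho sigma tau _ _ _; exact: Jab'_tens.
split; first by move=> n m a b rho sigma E ha b0 _; exact: Jab'_cptp.
split; first by move=> n a b rho sigma U _ _ _; exact: Jab'_unitary.
split; first exact: Jab'_convex.
by move=> n a b rho sigma _ _ _ _ _; exact: Jab'C.
Qed.
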